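(* Let $k$ be a field and let $S\subset\mathbb{N}$ be a cofinite proper submonoid which is generated by two elements. Let $k[S]\subset k[x]$ be the numerical semigroup algebra. Then the global dimension of the endomorphism algebra $\Gamma_S$ of the standard tilting object $V_S$ in $\underline{\mathrm{CM}}^{\mathbb{Z}}k[S]$ is less than or equal to $2$.
   Context: $\mathbb{N}$ is the additive monoid of non-negative integers. $k[S]$ is the subalgebra of $k[x]$ spanned by $x^s$, $s\in S$, graded by $\deg x^s=s$; since $S$ is generated by two elements it is a graded Gorenstein (hypersurface) ring of Krull dimension one with degree-zero part $k$. $\mathrm{CM}^{\mathbb{Z}}k[S]$ is the Frobenius category of finitely generated $\mathbb{Z}$-graded maximal Cohen--Macaulay $k[S]$-modules with degree-$0$ homogeneous morphisms, and $\underline{\mathrm{CM}}^{\mathbb{Z}}k[S]$ is its stable category. The $a$-invariant $a$ of $R=k[S]$ is the unique integer with $\mathrm{Ext}^1_R(k,R(a))\cong k$ as graded modules, where $M(i)_j=M_{i+j}$. The standard tilting object is $V_S=\bigoplus_{i=1}^{a+1}k[S](i)_{\ge0}$, where $M_{\ge0}$ denotes truncation in non-negative degrees; its endomorphism algebra $\Gamma_S$ is taken in $\underline{\mathrm{CM}}^{\mathbb{Z}}k[S]$. *)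

(* Defs.v *)
From HB Require Import structures.
From mathcomp Require Import all_boot all_order all_algebra.
From mathcomp Require Import generic_quotient.
From mathcomp Require Import boolp classical_sets functions.

Set Implicit Arguments.
Unset Strict Implicit.
Unset Printing Implicit Defensive.

Import GRing.Theory Num.Theory.

Local Open Scope quotient_scope.
Local Open Scope classical_set_scope.
Local Open Scope ring_scope.

Definition submonoid (A : set nat) : Prop :=
  A 0%N /\ forall m n, A m -> A n -> A (m + n)%N.

Record natSubmonoid := NatSubmonoid {
  smset :> set nat;
  smsetP : submonoid smset
}.

Section SemigroupAlgebra.
Variables (k : fieldType) (S : natSubmonoid).

Definition sgalg_pred : {pred {poly k}} :=
  fun p => `[< forall i, p`_i != 0 -> smset S i >].

Lemma sgalg_predP (p : {poly k}) :
  reflect (forall i, p`_i != 0 -> smset S i) (p \in sgalg_pred).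
Proof. exact: asboolP. Qed.

Lemma sgalg_subring_closed : subring_closed sgalg_pred.
Proof.
have [S0 SD] := smsetP S; split.
- apply/sgalg_predP => i; rewrite coef1.
  by case: i => [//|i]; rewrite eqxx.
- move=> p q /sgalg_predP Hp /sgalg_predP Hq; apply/sgalg_predP => i.
  rewrite coefB; have [p0|/Hp //] := eqVneq p`_i 0.
  by rewrite p0 sub0r oppr_eq0 => /Hq.
- move=> p q /sgalg_predP Hp /sgalg_predP Hq; apply/sgalg_predP => i.
  rewrite coefM => Hi.
  have [j Hj] : exists j : 'I_i.+1, p`_j * q`_(i - j) != 0.
    apply/existsP; move: Hi; apply: contraR; rewrite negb_exists.
    move=> /forallP H; rewrite big1 // => j _.
    by move: (H j); rewrite negbK => /eqP.
  move: Hj; rewrite mulf_eq0 negb_or => /andP[/Hp Sj /Hq Sij].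
  have ji : (j <= i)%N by rewrite -ltnS.
  by rewrite -(subnKC ji); apply: SD.
Qed.

HB.instance Definition _ :=
  GRing.isSubringClosed.Build {poly k} sgalg_pred sgalg_subring_closed.

Record sgalg := SgAlg { sgalg_val :> {poly k}; _ : sgalg_val \in sgalg_pred }.

HB.instance Definition _ := [isSub for sgalg_val].
HB.instance Definition _ := [Choice of sgalg by <:].
HB.instance Definition _ := [SubChoice_isSubComNzRing of sgalg by <:].

(** [sgalg_deg d] is the degree-[d] part of k[S]; it is 0 for [d < 0]. *)
Definition sgalg_deg (d : int) : set sgalg :=
  [set r : sgalg | forall i : nat, i%:Z != d -> (sgalg_val r)`_i = 0].

Definition sgalg_max : set sgalg := [set r : sgalg | (sgalg_val r)`_0 = 0].

End SemigroupAlgebra.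

Section HomogeneousSums.
Variable M : zmodType.

Definition homog_sum (pc : int -> set M) (D : set int) : set M :=
  [set x | exists s : seq M,
     (forall y, y \in s -> exists2 j, D j & pc j y) /\ x = \sum_(y <- s) y].

Lemma homog_sum0 pc D : homog_sum pc D 0.
Proof. by exists [::]; rewrite big_nil. Qed.

Lemma homog_sumD pc D x y :
  homog_sum pc D x -> homog_sum pc D y -> homog_sum pc D (x + y).
Proof.
move=> [s [Hs ->]] [t [Ht ->]]; exists (s ++ t); rewrite big_cat; split=> // z.
by rewrite mem_cat => /orP[/Hs|/Ht].
Qed.

Lemma homog_sum_big pc D I (r : seq I) (F : I -> M) :
  (forall i, homog_sum pc D (F i)) -> homog_sum pc D (\sum_(i <- r) F i).
Proof.
by move=> H; elim/big_ind: _ => [|x y|i _];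
  [exact: homog_sum0|exact: homog_sumD|exact: H].
Qed.

Lemma homog_sum1 (pc : int -> set M) (D : set int) j x :
  D j -> pc j x -> homog_sum pc D x.
Proof.
move=> Dj xj; exists [:: x]; rewrite big_seq1; split=> // y.
by rewrite inE => /eqP ->; exists j.
Qed.

End HomogeneousSums.

Lemma homog_sum_map (M N : zmodType) (f : M -> N) pcM pcN (D D' : set int) x :
  f 0 = 0 -> {morph f : x y / x + y} ->
  (forall j y, D j -> pcM j y -> exists2 i, D' i & pcN i (f y)) ->
  homog_sum pcM D x -> homog_sum pcN D' (f x).
Proof.
move=> f0 fD fpc [s [Hs ->]]; exists (map f s); rewrite big_map; split.
  by move=> y /mapP[z /Hs[j Dj zj] ->]; apply: fpc zj.
by rewrite (big_morph f fD f0).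
Qed.

Section GradedModules.
Variables (k : fieldType) (S : natSubmonoid).
Local Notation R := (sgalg k S).

(** A Z-graded k[S]-module is a k[S]-module which is the (internal) direct sum
    of additive subgroups [grpc j], [j : int], compatibly with the grading of
    k[S]. *)
Record grmod := GrMod {
  grcar :> lmodType R;
  grpc : int -> set grcar;
  grpc0 : forall j, grpc j 0;
  grpcB : forall j x y, grpc j x -> grpc j y -> grpc j (x - y);
  grpcZ : forall d j r x, sgalg_deg d r -> grpc j x -> grpc (d + j) (r *: x);
  grpc_span : forall x, homog_sum grpc setT x;
  grpc_indep : forall (J : seq int) (f : int -> grcar), uniq J ->
    (forall j, grpc j (f j)) -> \sum_(j <- J) f j = 0 ->
    forall j, j \in J -> f j = 0
}.
Arguments grpc : clear implicits.

(** Homogeneous k[S]-linear maps of degree [d]. *)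
Definition homdeg (d : int) (M N : grmod) (f : M -> N) : Prop :=
  linear f /\ forall j x, grpc M j x -> grpc N (j + d) (f x).

Definition surj (A B : Type) (f : A -> B) : Prop := forall y, exists x, f x = y.

(** The shift M(i), with M(i)_j = M_(i + j). *)
Section Shift.
Variables (M : grmod) (i : int).

Definition shift_pc (j : int) : set M := grpc M (i + j).

Lemma shift_pcZ d j r x :
  sgalg_deg d r -> shift_pc j x -> shift_pc (d + j) (r *: x).
Proof. by move=> dr jx; rewrite /shift_pc addrCA; apply: grpcZ. Qed.

Lemma shift_span x : homog_sum shift_pc setT x.
Proof.
have := grpc_span x; apply: (homog_sum_map (f := id)) => // j y _ yj.
by exists (j - i) => //; rewrite /shift_pc addrC subrK.
Qed.

Lemma shift_indep (J : seq int) (f : int -> M) : uniq J ->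
  (forall j, shift_pc j (f j)) -> \sum_(j <- J) f j = 0 ->
  forall j, j \in J -> f j = 0.
Proof.
move=> uJ fj sf j jJ.
have inj : injective (fun j : int => i + j) by apply: addrI.
have -> : f j = f ((i + j) - i) by rewrite addrAC subrr add0r.
apply: (@grpc_indep M (map (fun j => i + j) J) (fun l => f (l - i))).
- by rewrite map_inj_uniq.
- by move=> l; have := fj (l - i); rewrite /shift_pc addrC subrK.
- rewrite big_map -[RHS]sf; apply: eq_bigr => l _.
  by rewrite addrAC subrr add0r.
- by rewrite mem_map.
Qed.

Definition shift : grmod :=
  @GrMod M shift_pc (fun j => grpc0 M (i + j)) (fun j => @grpcB M (i + j))
    shift_pcZ shift_span shift_indep.

End Shift.

Lemma sgalg_homog_sum (r : R) :
  homog_sum (@sgalg_deg k S) [set d | 0 <= d] r.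
Proof.
have mono i : (sgalg_val r)`_i *: 'X^i \in sgalg_pred S.
  apply/sgalg_predP => j; rewrite coefZ coefXn; case: (eqVneq j i) => [->|].
    by rewrite mulr1; move/sgalg_predP: (valP r); apply.
  by rewrite mulr0 eqxx.
have -> : r = \sum_(i < size (val r)) (SgAlg (mono i) : R).
  apply: val_inj; rewrite raddf_sum /= -[LHS]coefK poly_def.
  by apply: eq_bigr.
apply: homog_sum_big => i; apply: (@homog_sum1 _ _ _ i%:Z) => // j ij /=.
by rewrite coefZ coefXn (negPf (_ : j != i)) ?mulr0.
Qed.

Section Truncation.
Variable M : grmod.

Definition trunc_pred : {pred M} :=
  fun x => `[< homog_sum (grpc M) [set j | 0 <= j] x >].

Lemma trunc_predP x :
  reflect (homog_sum (grpc M) [set j | 0 <= j] x) (x \in trunc_pred).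
Proof. exact: asboolP. Qed.

Lemma trunc_submod_closed : submod_closed trunc_pred.
Proof.
split; first by apply/trunc_predP; apply: homog_sum0.
move=> r x y /trunc_predP Hx /trunc_predP Hy; apply/trunc_predP.
apply: homog_sumD => //.
have [s [Hs ->]] := sgalg_homog_sum r; have [t [Ht ->]] := Hx.
rewrite scaler_suml big_seq; elim/big_ind: _ => [|u v|a /Hs[d d0 ad]].
- exact: homog_sum0.
- exact: homog_sumD.
rewrite scaler_sumr big_seq; elim/big_ind: _ => [|u v|b /Ht[j j0 bj]].
- exact: homog_sum0.
- exact: homog_sumD.
apply: (@homog_sum1 _ _ _ (d + j)); last exact: grpcZ.
exact: addr_ge0.
Qed.

HB.instance Definition _ :=
  GRing.isSubmodClosed.Build R M trunc_pred trunc_submod_closed.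

Record trunc_car := TruncCar { trunc_val :> M; _ : trunc_val \in trunc_pred }.

HB.instance Definition _ := [isSub for trunc_val].
HB.instance Definition _ := [Choice of trunc_car by <:].
HB.instance Definition _ := [SubChoice_isSubLmodule of trunc_car by <:].

Definition trunc_pc (j : int) : set trunc_car := [set x | grpc M j (val x)].

Lemma trunc_pcB j x y : trunc_pc j x -> trunc_pc j y -> trunc_pc j (x - y).
Proof. exact: grpcB. Qed.

Lemma trunc_pcZ d j r x :
  sgalg_deg d r -> trunc_pc j x -> trunc_pc (d + j) (r *: x).
Proof. by move=> dr jx; apply: (grpcZ dr jx). Qed.

Lemma trunc_span x : homog_sum trunc_pc setT x.
Proof.
have /trunc_predP[s [Hs xs]] := valP x.
have sP y : y \in s -> y \in trunc_pred.
  by move=> /Hs[j j0 yj]; apply/trunc_predP; apply: homog_sum1 yj.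
exists (pmap insub s); split.
  move=> y; rewrite mem_pmap_sub => /Hs[j _ yj]; exists j => //.
apply: val_inj; rewrite raddf_sum [LHS]xs /=.
elim: s sP {Hs xs} => [|y s IH] sP; first by rewrite !big_nil.
have ys : y \in trunc_pred by apply: sP; rewrite mem_head.
rewrite big_cons IH /=; last by move=> z zs; apply: sP; rewrite inE zs orbT.
by rewrite insubT /= big_cons.
Qed.

Lemma trunc_indep (J : seq int) (f : int -> trunc_car) : uniq J ->
  (forall j, trunc_pc j (f j)) -> \sum_(j <- J) f j = 0 ->
  forall j, j \in J -> f j = 0.
Proof.
move=> uJ fj sf j jJ; apply: val_inj.
apply: (@grpc_indep M J (fun j => val (f j))) => //.
by rewrite -raddf_sum sf.
Qed.

Definition trunc : grmod :=
  @GrMod trunc_car trunc_pc (fun j => grpc0 M j) trunc_pcB trunc_pcZ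
    trunc_span trunc_indep.

End Truncation.

Section DirectSum.
Variables (I : finType) (M : I -> grmod).

Definition dsum_car := forall i, M i.

HB.instance Definition _ := Choice.on dsum_car.

Definition dsum_add (x y : dsum_car) : dsum_car := fun i => x i + y i.
Definition dsum_opp (x : dsum_car) : dsum_car := fun i => - x i.
Definition dsum_zero : dsum_car := fun i => 0.
Definition dsum_scale (r : R) (x : dsum_car) : dsum_car := fun i => r *: x i.

Fact dsum_addA : associative dsum_add.
Proof. by move=> x y z; apply: functional_extensionality_dep => i; apply: addrA. Qed.
Fact dsum_addC : commutative dsum_add.
Proof. by move=> x y; apply: functional_extensionality_dep => i; apply: addrC. Qed.
Fact dsum_add0 : left_id dsum_zero dsum_add.
Proof. by move=> x; apply: functional_extensionality_dep => i; apply: add0r. Qed.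
Fact dsum_addN : left_inverse dsum_zero dsum_opp dsum_add.
Proof. by move=> x; apply: functional_extensionality_dep => i; apply: addNr. Qed.

HB.instance Definition _ :=
  GRing.isZmodule.Build dsum_car dsum_addA dsum_addC dsum_add0 dsum_addN.

Fact dsum_scaleA r s (x : dsum_car) :
  dsum_scale r (dsum_scale s x) = dsum_scale (r * s) x.
Proof. by apply: functional_extensionality_dep => i; apply: scalerA. Qed.
Fact dsum_scale1 : left_id 1 dsum_scale.
Proof. by move=> x; apply: functional_extensionality_dep => i; apply: scale1r. Qed.
Fact dsum_scaleDr : right_distributive dsum_scale +%R.
Proof.
by move=> r x y; apply: functional_extensionality_dep => i; apply: scalerDr.
Qed.
Fact dsum_scaleDl (x : dsum_car) : {morph dsum_scale^~ x : r s / r + s}.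
Proof.
by move=> r s; apply: functional_extensionality_dep => i; apply: scalerDl.
Qed.

HB.instance Definition _ := GRing.Zmodule_isLmodule.Build R dsum_car
  dsum_scaleA dsum_scale1 dsum_scaleDr dsum_scaleDl.

Definition dsum_pc (j : int) : set dsum_car :=
  [set x | forall i, grpc (M i) j (x i)].

Lemma dsum_pc0 j : dsum_pc j 0.
Proof. by move=> i; apply: grpc0. Qed.

Lemma dsum_pcB j x y : dsum_pc j x -> dsum_pc j y -> dsum_pc j (x - y).
Proof. by move=> Hx Hy i; apply: grpcB. Qed.

Lemma dsum_pcZ d j r x :
  sgalg_deg d r -> dsum_pc j x -> dsum_pc (d + j) (r *: x).
Proof. by move=> dr jx i; apply: grpcZ. Qed.

Lemma dsum_sumE T (s : seq T) (F : T -> dsum_car) i :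
  (\sum_(t <- s) F t) i = \sum_(t <- s) F t i.
Proof. by apply: (big_morph (fun x : dsum_car => x i)). Qed.

Lemma dsum_span x : homog_sum dsum_pc setT x.
Proof.
pose inj i (y : M i) : dsum_car :=
    @dfwith I (fun j => M j) (fun j => 0) i y.
have -> : x = \sum_(i <- enum I) inj i (x i).
  apply: functional_extensionality_dep => i; rewrite dsum_sumE big_enum /=.
  rewrite (bigD1 i) //= {1}/inj dfwith_in big1 ?addr0 // => j ji.
  by rewrite /inj dfwith_out.
apply: homog_sum_big => i.
apply: (homog_sum_map _ _ _ (grpc_span (x i))).
- apply: functional_extensionality_dep => j; rewrite /inj.
  by case: dfwithP.
- move=> y z; apply: functional_extensionality_dep => j.
  have [ij|ij] := eqVneq i j; last first.
    by rewrite -[RHS]/(inj i y j + inj i z j) /inj !dfwith_out // addr0.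
  by case: _ / ij; rewrite -[RHS]/(inj i y i + inj i z i) /inj !dfwith_in.
- move=> j y _ yj; exists j => // l; rewrite /inj.
  by case: dfwithP => // *; apply: grpc0.
Qed.

Lemma dsum_indep (J : seq int) (f : int -> dsum_car) : uniq J ->
  (forall j, dsum_pc j (f j)) -> \sum_(j <- J) f j = 0 ->
  forall j, j \in J -> f j = 0.
Proof.
move=> uJ fj sf j jJ; apply: functional_extensionality_dep => i.
apply: (@grpc_indep (M i) J (fun j => f j i)) => //.
  by move=> l; apply: fj.
by rewrite -dsum_sumE sf.
Qed.

Definition dsum : grmod :=
  @GrMod dsum_car dsum_pc dsum_pc0 dsum_pcB dsum_pcZ dsum_span dsum_indep.

End DirectSum.

Section Regular.

Definition reg_pc (j : int) : set (R^o : lmodType R) := @sgalg_deg k S j.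

Lemma reg_pc0 j : reg_pc j 0.
Proof. by move=> i _; rewrite coef0. Qed.

Lemma reg_pcB j x y : reg_pc j x -> reg_pc j y -> reg_pc j (x - y).
Proof. by move=> Hx Hy i ij; rewrite coefB Hx // Hy // subr0. Qed.

Lemma reg_pcZ d j r x :
  sgalg_deg d r -> reg_pc j x -> reg_pc (d + j) (r *: x).
Proof.
move=> dr jx i ij; rewrite coefM big1 // => l _.
have [ld|/dr -> //] := eqVneq l%:Z d; last by rewrite mul0r.
rewrite jx ?mulr0 //; apply: contra ij => /eqP <-.
by rewrite -ld -PoszD subnKC // -ltnS.
Qed.

Lemma reg_span x : homog_sum reg_pc setT x.
Proof.
have [s [Hs ->]] := sgalg_homog_sum x.
by exists s; split=> // y /Hs[j]; exists j.
Qed.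

Lemma reg_indep (J : seq int) (f : int -> R^o) : uniq J ->
  (forall j, reg_pc j (f j)) -> \sum_(j <- J) f j = 0 ->
  forall j, j \in J -> f j = 0.
Proof.
move=> uJ fj sf j jJ; apply: val_inj; apply/polyP => i; rewrite coef0.
have [ij|/fj //] := eqVneq i%:Z j.
have := congr1 (fun r : R => (sgalg_val r)`_i) sf.
rewrite (big_morph (fun r : R => (sgalg_val r)`_i) (id1 := 0) (op1 := +%R));
  [|by move=> x y; rewrite coefD|by rewrite coef0].
rewrite coef0 (bigD1_seq j) //= big1 ?addr0 // => l lj.
by apply: fj; rewrite ij eq_sym.
Qed.

Definition reg : grmod :=
  @GrMod (R^o : lmodType R) reg_pc reg_pc0 reg_pcB reg_pcZ reg_span reg_indep.

End Regular.

(** The residue field k = k[S]/(homogeneous maximal ideal), in degree 0. *)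
Section ResidueField.

Definition resfield : Type := k.
HB.instance Definition _ := GRing.Zmodule.on resfield.

Definition resfield_scale (r : R) (c : resfield) : resfield := (sgalg_val r)`_0 * c.

Fact resfield_scaleA r s c :
  resfield_scale r (resfield_scale s c) = resfield_scale (r * s) c.
Proof. by rewrite /resfield_scale coefM big_ord1 mulrA. Qed.
Fact resfield_scale1 : left_id 1 resfield_scale.
Proof. by move=> c; rewrite /resfield_scale coef1 mul1r. Qed.
Fact resfield_scaleDr : right_distributive resfield_scale +%R.
Proof. by move=> r x y; apply: mulrDr. Qed.
Fact resfield_scaleDl c : {morph resfield_scale^~ c : r s / r + s}.
Proof. by move=> r s; rewrite /resfield_scale coefD mulrDl. Qed.

HB.instance Definition _ := GRing.Zmodule_isLmodule.Build R resfield
  resfield_scaleA resfield_scale1 resfield_scaleDr resfield_scaleDl.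

Definition resfield_pc (j : int) : set resfield := [set c | j != 0 -> c = 0].

Lemma resfield_pc0 j : resfield_pc j 0. Proof. by []. Qed.

Lemma resfield_pcB j x y :
  resfield_pc j x -> resfield_pc j y -> resfield_pc j (x - y).
Proof. by move=> Hx Hy j0; rewrite Hx // Hy // subr0. Qed.

Lemma resfield_pcZ d j r x :
  sgalg_deg d r -> resfield_pc j x -> resfield_pc (d + j) (r *: x).
Proof.
move=> dr jx dj; have [j0|/jx ->] := eqVneq j 0; last by rewrite scaler0.
rewrite -[LHS]/((sgalg_val r)`_0 * x) dr ?mul0r //.
by apply: contra dj => /eqP <-; rewrite j0.
Qed.

Lemma resfield_span x : homog_sum resfield_pc setT x.
Proof. by apply: (@homog_sum1 _ _ _ 0); rewrite ?eqxx //= => /eqP. Qed.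

Lemma resfield_indep (J : seq int) (f : int -> resfield) : uniq J ->
  (forall j, resfield_pc j (f j)) -> \sum_(j <- J) f j = 0 ->
  forall j, j \in J -> f j = 0.
Proof.
move=> uJ fj sf j jJ; have [j0|/fj //] := eqVneq j 0.
move: sf; rewrite (bigD1_seq j) //= big1 ?addr0 // => l lj.
by apply: fj; rewrite -j0.
Qed.

Definition kgr : grmod :=
  @GrMod resfield resfield_pc resfield_pc0 resfield_pcB resfield_pcZ
    resfield_span resfield_indep.

End ResidueField.

(** [P] is a projective object of the full subcategory [C] of graded modules
    (with degree-0 homogeneous maps): it lifts through every surjection
    between objects of [C]. *)
Definition projective_in (C : grmod -> Prop) (P : grmod) : Prop :=
  C P /\ forall (M N : grmod) (g : M -> N) (f : P -> N),
    C M -> C N -> homdeg 0 g -> surj g -> homdeg 0 f ->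
    exists2 h : P -> M, homdeg 0 h & forall x, g (h x) = f x.

Definition gr_projective : grmod -> Prop := projective_in (fun=> True).

(** [E] is isomorphic, as a graded module, to the graded module
    Ext^1_R(M, N): for a projective presentation 0 -> Om -> P -> M -> 0, the
    map [delta] presents [E] as the cokernel of the restriction map
    *Hom(P, N) -> *Hom(Om, N), where *Hom_d is the group of homogeneous maps of
    degree [d]. Only the values [delta d f] with [f] of degree [d] matter. *)
Definition is_Ext1 (M N E : grmod) : Prop :=
  exists (P Om : grmod) (iota : Om -> P) (pr : P -> M),
  [/\ gr_projective P,
      homdeg 0 iota /\ injective iota,
      homdeg 0 pr /\ surj pr,
      forall y, pr y = 0 <-> exists x, iota x = y &
      exists delta : int -> (Om -> N) -> E,
      [/\ forall d f, homdeg d f -> grpc E d (delta d f),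
          forall d f g, homdeg d f -> homdeg d g ->
            delta d (f \+ g) = delta d f + delta d g,
          forall e d r f, sgalg_deg e r -> homdeg d f ->
            delta (e + d) (r \*: f) = r *: delta d f,
          forall d y, grpc E d y -> exists2 f, homdeg d f & delta d f = y &
          forall d f, homdeg d f ->
            (delta d f = 0 <->
             exists2 g : P -> N, homdeg d g & forall x, g (iota x) = f x)]].

Definition is_a_invariant (a : int) : Prop := is_Ext1 kgr (shift reg a) kgr.

Definition fin_gen (M : lmodType R) : Prop :=
  exists (n : nat) (g : 'I_n -> M),
  forall x, exists c : 'I_n -> R, x = \sum_i c i *: g i.

(** As k[S] has Krull dimension one, a finitely generated graded module is
    maximal Cohen-Macaulay when it is zero or has depth at least one at the
    homogeneous maximal ideal m, i.e. when Hom(k, M) = 0: no nonzero element is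
    killed by m. *)
Definition CM (M : grmod) : Prop :=
  fin_gen M /\
  forall x : M, (forall r : R, sgalg_max r -> r *: x = 0) -> x = 0.

(** The exact structure of CM consists of the short exact sequences of graded
    modules with terms in CM. The kernel of a surjection between modules in CM
    is again in CM (k[S] is Noetherian and submodules inherit the condition on
    m), so the projective objects of this exact category are the following. *)
Definition CM_projective : grmod -> Prop := projective_in CM.

Section Hom.
Variables M N : grmod.

Definition ghom_pred : {pred (M -> N)} := fun f => `[< homdeg 0 f >].

Lemma ghom_predP (f : M -> N) : reflect (homdeg 0 f) (f \in ghom_pred).
Proof. exact: asboolP. Qed.

Lemma ghom_zmod_closed : zmod_closed ghom_pred.
Proof.
split.
  apply/ghom_predP; split; first by move=> r x y /=; rewrite scaler0 addr0.
  by move=> j x _; apply: grpc0.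
move=> f g /ghom_predP[fl fd] /ghom_predP[gl gd]; apply/ghom_predP; split.
  move=> r x y; rewrite -[LHS]/(f (r *: x + y) - g (r *: x + y)) fl gl.
  by rewrite opprD addrACA scalerBr.
by move=> j x jx; apply: grpcB; [apply: fd|apply: gd].
Qed.

HB.instance Definition _ :=
  GRing.isZmodClosed.Build (M -> N) ghom_pred ghom_zmod_closed.

Record ghom := GHom { ghom_val :> M -> N; ghomP : ghom_val \in ghom_pred }.

HB.instance Definition _ := [isSub for ghom_val].
HB.instance Definition _ := [Choice of ghom by <:].
HB.instance Definition _ := [SubChoice_isSubZmodule of ghom by <:].

Lemma ghom_eq (f g : ghom) : f =1 g -> f = g.
Proof. by move=> fg; apply: val_inj; apply: funext. Qed.

Lemma ghom_homdeg (f : ghom) : homdeg 0 f.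
Proof. by apply/ghom_predP; case: f. Qed.

Lemma ghomD (f : ghom) : {morph f : x y / x + y}.
Proof.
by move=> x y; have [fl _] := ghom_homdeg f; have := fl 1 x y; rewrite !scale1r.
Qed.

Lemma ghomB (f : ghom) : {morph f : x y / x - y}.
Proof.
move=> x y; have [fl _] := ghom_homdeg f.
by have := fl (-1) y x; rewrite !scaleN1r !(addrC (- _)).
Qed.

End Hom.
Arguments ghom_pred : clear implicits.

Lemma ghom_id_pred (M : grmod) : (id : M -> M) \in ghom_pred M M.
Proof. by apply/ghom_predP; split=> // j x; rewrite addr0. Qed.
Definition ghom_id (M : grmod) : ghom M M := GHom (ghom_id_pred M).

Lemma ghom_comp_pred (L M N : grmod) (g : ghom M N) (f : ghom L M) :
  g \o f \in ghom_pred L N.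
Proof.
have [gl gd] := ghom_homdeg g; have [fl fd] := ghom_homdeg f.
apply/ghom_predP; split; first by move=> r x y /=; rewrite fl gl.
by move=> j x jx /=; have := gd _ _ (fd _ _ jx); rewrite !addr0.
Qed.
Definition ghom_comp (L M N : grmod) (g : ghom M N) (f : ghom L M) : ghom L N :=
  GHom (ghom_comp_pred g f).

Lemma ghom_compBl (L M N : grmod) (g h : ghom M N) (f : ghom L M) :
  ghom_comp (g - h) f = ghom_comp g f - ghom_comp h f.
Proof. exact: ghom_eq. Qed.

Lemma ghom_compBr (L M N : grmod) (g : ghom M N) (f h : ghom L M) :
  ghom_comp g (f - h) = ghom_comp g f - ghom_comp g h.
Proof. by apply: ghom_eq => x; apply: ghomB. Qed.

Definition stab_pred (M N : grmod) : {pred (ghom M N)} :=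
  fun f => `[< exists P, CM_projective P /\
    exists (g : ghom P N) (h : ghom M P), f = ghom_comp g h >].

Arguments stab_pred : clear implicits.

Lemma stab_predP (M N : grmod) (f : ghom M N) :
  reflect (exists P, CM_projective P /\
    exists (g : ghom P N) (h : ghom M P), f = ghom_comp g h)
  (f \in stab_pred M N).
Proof. exact: asboolP. Qed.

Lemma CM_projective0 : CM_projective (dsum (fun i : 'I_0 => kgr)).
Proof.
have E (x y : dsum (fun i : 'I_0 => kgr)) : x = y.
  by apply: functional_extensionality_dep => -[].
split; first split.
- by exists 0%N, (fun _ => 0) => x; exists (fun _ => 0).
- by move=> x _.
move=> M N g f _ _ [gl gd] _ [fl fd]; exists (fun _ => 0).
  by split=> [r x y|j x _]; [rewrite scaler0 addr0|apply: grpc0].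
have z0 (A B : grmod) (u : A -> B) : linear u -> u 0 = 0.
  by move=> ul; have := ul (-1) 0 0; rewrite !scaleN1r oppr0 addr0 addNr.
by move=> x; rewrite (E x 0) !z0.
Qed.

Section Sum2.
Variables P Q : grmod.
Definition sum2_fam (b : bool) := if b then P else Q.
Definition sum2 : grmod := dsum sum2_fam.

Definition sum2_pair (x : P) (y : Q) : sum2 :=
  fun b => if b return sum2_fam b then x else y.

Lemma sum2_pairE (z : sum2) : sum2_pair (z true) (z false) = z.
Proof. by apply: functional_extensionality_dep => -[]. Qed.

Lemma sum2_pairL r x y x' y' : sum2_pair (r *: x + x') (r *: y + y') =
  r *: sum2_pair x y + sum2_pair x' y'.
Proof. by apply: functional_extensionality_dep => -[]. Qed.

Lemma CM_projective_sum : CM_projective P -> CM_projective Q ->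
  CM_projective sum2.
Proof.
move=> [[[m [g gP]] tP] lP] [[[n [h hQ]] tQ] lQ]; split; first split.
- exists (m + n)%N, (fun i : 'I_(m + n)%N => match fintype.split i with
    | inl i => sum2_pair (g i) 0 | inr j => sum2_pair 0 (h j) end).
  move=> z; have [c cz] := gP (z true); have [d dz] := hQ (z false).
  exists (fun i : 'I_(m + n)%N => match fintype.split i with
    | inl i => c i | inr j => d j end).
  rewrite big_split_ord /=.
  under eq_bigr => i _ do rewrite (unsplitK (inl i)).
  under [X in _ = _ + X]eq_bigr => i _ do rewrite (unsplitK (inr i)).
  apply: functional_extensionality_dep => b.
  rewrite -[RHS]/((_ : dsum_car sum2_fam) b + (_ : dsum_car sum2_fam) b) !dsum_sumE.
  case: b.
  + rewrite [X in _ + X]big1 ?addr0 //.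
    by move=> i _; rewrite -[LHS]/(_ *: (0 : P)) scaler0.
  + rewrite [X in X + _]big1 ?add0r //.
    by move=> i _; rewrite -[LHS]/(_ *: (0 : Q)) scaler0.
- move=> z Hz; rewrite -(sum2_pairE z).
  have -> : z true = 0.
    by apply: tP => r /Hz/(congr1 (fun w : sum2 => w true)).
  have -> : z false = 0.
    by apply: tQ => r /Hz/(congr1 (fun w : sum2 => w false)).
  by apply: functional_extensionality_dep => -[].
- move=> M N u f CMM CMN uh us [fl fd].
  have f1 : homdeg 0 (fun x => f (sum2_pair x 0)).
    split=> [r x y|j x jx].
      by rewrite -fl -sum2_pairL scaler0 addr0.
    by apply: fd => -[] //=; apply: grpc0.
  have f2 : homdeg 0 (fun y => f (sum2_pair 0 y)).
    split=> [r x y|j x jx].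
      by rewrite -fl -sum2_pairL scaler0 addr0.
    by apply: fd => -[] //=; apply: grpc0.
  have [v [vl vd] vE] := lP M N u _ CMM CMN uh us f1.
  have [w [wl wd] wE] := lQ M N u _ CMM CMN uh us f2.
  have [ul ud] := uh.
  exists (fun z : sum2 => v (z true) + w (z false)).
    split=> [r x y|j x jx].
      rewrite -[(r *: x + y) true]/(r *: x true + y true).
      rewrite -[(r *: x + y) false]/(r *: x false + y false).
      by rewrite vl wl scalerDr addrACA.
    rewrite -[w _]opprK; apply: grpcB; first by apply: vd; apply: (jx true).
    rewrite -sub0r; apply: grpcB; first exact: grpc0.
    by apply: wd; apply: (jx false).
  move=> x; rewrite -[X in _ = f X]sum2_pairE.
  have := ul 1 (v (x true)) (w (x false)); rewrite !scale1r => ->.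
  rewrite vE wE; have := fl 1 (sum2_pair (x true) 0) (sum2_pair 0 (x false)).
  by rewrite !scale1r => <-; rewrite -[sum2_pair (x true) 0]scale1r -sum2_pairL !scale1r
    addr0 add0r.
Qed.

Lemma stab_pred_sum (M N : grmod) (g : ghom P N) (h : ghom M P)
    (g' : ghom Q N) (h' : ghom M Q) :
  exists (u : ghom sum2 N) (v : ghom M sum2),
    ghom_comp g h - ghom_comp g' h' = ghom_comp u v.
Proof.
have [gl gd] := ghom_homdeg g; have [hl hd] := ghom_homdeg h.
have [gl' gd'] := ghom_homdeg g'; have [hl' hd'] := ghom_homdeg h'.
have up : (fun z : sum2 => g (z true) - g' (z false)) \in ghom_pred sum2 N.
  apply/ghom_predP; split=> [r x y|j x jx].
    rewrite -[(r *: x + y) true]/(r *: x true + y true).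
    rewrite -[(r *: x + y) false]/(r *: x false + y false).
    by rewrite gl gl' scalerBr opprD addrACA.
  by apply: grpcB; [apply: gd; apply: (jx true)|apply: gd'; apply: (jx false)].
have vp : (fun x => sum2_pair (h x) (h' x)) \in ghom_pred M sum2.
  apply/ghom_predP; split=> [r x y|j x jx]; first by rewrite hl hl' sum2_pairL.
  by case; [apply: hd|apply: hd'].
by exists (GHom up), (GHom vp); apply: ghom_eq.
Qed.

End Sum2.

Lemma stab_zmod_closed (M N : grmod) : zmod_closed (stab_pred M N).
Proof.
split.
  apply/stab_predP; exists (dsum (fun i : 'I_0 => kgr)).
  split; first exact: CM_projective0.
  by exists 0, 0; apply: ghom_eq.
move=> f f' /stab_predP[P [HP [g [h ->]]]] /stab_predP[Q [HQ [g' [h' ->]]]].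
apply/stab_predP; have [u [v ->]] := stab_pred_sum g h g' h'.
by exists (sum2 P Q); split; [exact: CM_projective_sum|exists u, v].
Qed.

HB.instance Definition _ (M N : grmod) :=
  GRing.isZmodClosed.Build (ghom M N) (stab_pred M N) (stab_zmod_closed M N).

Lemma stab_compl (L M N : grmod) (g : ghom M N) (f : ghom L M) :
  f \in stab_pred L M -> ghom_comp g f \in stab_pred L N.
Proof.
move=> /stab_predP[P [HP [u [v ->]]]]; apply/stab_predP; exists P; split=> //.
by exists (ghom_comp g u), v; apply: ghom_eq.
Qed.

Lemma stab_compr (L M N : grmod) (g : ghom M N) (f : ghom L M) :
  g \in stab_pred M N -> ghom_comp g f \in stab_pred L N.
Proof.
move=> /stab_predP[P [HP [u [v ->]]]]; apply/stab_predP; exists P; split=> //.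
by exists u, (ghom_comp v f); apply: ghom_eq.
Qed.

Definition stab_hom (M N : grmod) : zmodType :=
  {ideal_quot [the zmodClosed (ghom M N) of stab_pred M N]}.

Section StableEnd.
Variable M : grmod.

Definition stab_end : Type := stab_hom M M.
HB.instance Definition _ := GRing.Zmodule.on stab_end.

Definition stab_pi (f : ghom M M) : stab_end := \pi_(stab_hom M M) f.
Definition stab_repr (f : stab_end) : ghom M M := repr (f : stab_hom M M).

Definition stab_end_one : stab_end := stab_pi (ghom_id M).
Definition stab_end_mul (f g : stab_end) : stab_end :=
  stab_pi (ghom_comp (stab_repr f) (stab_repr g)).

Lemma stab_reprK f : stab_pi (stab_repr f) = f.
Proof. exact: reprK. Qed.

Lemma stab_piD (f g : ghom M M) : stab_pi (f + g) = stab_pi f + stab_pi g.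
Proof. exact: raddfD. Qed.

Lemma stab_pi_eq (f g : ghom M M) :
  stab_pi f = stab_pi g <-> f - g \in stab_pred M M.
Proof.
rewrite -/(f - g \in [the zmodClosed _ of stab_pred M M]).
by rewrite Quotient.idealrBE; split=> /eqP.
Qed.

Lemma stab_end_mulE (f g : ghom M M) :
  stab_end_mul (stab_pi f) (stab_pi g) = stab_pi (ghom_comp f g).
Proof.
apply/stab_pi_eq.
set f' := stab_repr _; set g' := stab_repr _.
have -> : ghom_comp f' g' - ghom_comp f g =
    ghom_comp (f' - f) g' + ghom_comp f (g' - g).
  by rewrite ghom_compBl ghom_compBr addrA subrK.
by apply: rpredD; [apply: stab_compr|apply: stab_compl];
  apply/stab_pi_eq; rewrite stab_reprK.
Qed.

Fact stab_end_mulA : associative stab_end_mul.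
Proof.
move=> x y z; rewrite -[x]stab_reprK -[y]stab_reprK -[z]stab_reprK.
by rewrite !stab_end_mulE; congr stab_pi; apply: ghom_eq.
Qed.

Fact stab_end_mul1l : left_id stab_end_one stab_end_mul.
Proof.
move=> x; rewrite -[x]stab_reprK stab_end_mulE.
by congr stab_pi; apply: ghom_eq.
Qed.

Fact stab_end_mul1r : right_id stab_end_one stab_end_mul.
Proof.
move=> x; rewrite -[x]stab_reprK stab_end_mulE.
by congr stab_pi; apply: ghom_eq.
Qed.

Fact stab_end_mulDl : left_distributive stab_end_mul +%R.
Proof.
move=> x y z; rewrite -[x]stab_reprK -[y]stab_reprK -[z]stab_reprK.
rewrite -stab_piD !stab_end_mulE -stab_piD.
by congr stab_pi; apply: ghom_eq.
Qed.

Fact stab_end_mulDr : right_distributive stab_end_mul +%R.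
Proof.
move=> x y z; rewrite -[x]stab_reprK -[y]stab_reprK -[z]stab_reprK.
rewrite -stab_piD !stab_end_mulE -stab_piD.
by congr stab_pi; apply: ghom_eq => t; apply: ghomD.
Qed.

HB.instance Definition _ := GRing.Zmodule_isPzRing.Build stab_end
  stab_end_mulA stab_end_mul1l stab_end_mul1r stab_end_mulDl stab_end_mulDr.

End StableEnd.

(** The summands are indexed by i = 1, ..., a + 1 (none if a < 0). *)
Definition nb_summands (a : int) : nat := if a is Posz n then n.+1 else 0%N.

Definition std_tilting (a : int) : grmod :=
  dsum (fun i : 'I_(nb_summands a) => trunc (shift reg i.+1%:Z)).

Definition Gamma (a : int) : pzRingType := stab_end (std_tilting a).

End GradedModules.
Arguments Gamma : clear implicits.
Arguments is_a_invariant : clear implicits.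

Definition projective_module (A : pzRingType) (P : lmodType A) : Prop :=
  forall (M N : lmodType A) (g : {linear M -> N}) (f : {linear P -> N}),
  surj g -> exists h : {linear P -> M}, forall x, g (h x) = f x.

(** [pd_le n M]: [M] has a projective resolution
    0 -> P_n -> ... -> P_0 -> M -> 0. *)
Fixpoint pd_le (A : pzRingType) (n : nat) (M : lmodType A) : Prop :=
  if n is m.+1 then
    exists (P K : lmodType A) (i : {linear K -> P}) (p : {linear P -> M}),
    [/\ projective_module P, injective i, surj p,
        forall y, p y = 0 <-> exists x, i x = y & pd_le m K]
  else projective_module M.

(** Right [A]-modules are left modules over the converse ring [A^c]. *)
Definition gldim_le (A : pzRingType) (n : nat) : Prop :=
  forall M : lmodType A^c, pd_le n M.

(* Main.v *)
Require Import Defs.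
From HB Require Import structures.
From mathcomp Require Import all_boot all_order all_algebra.
From mathcomp Require Import boolp classical_sets functions cardinality.
From mathcomp Require Import zify ring.

(** Let [S = <p, q>], [R = k[S]] and [n = pq - p - q], the Frobenius number of [S].
    A class generating [Ext^1(k, R(a))] shows that [a] is not in [S], while [a + s]
    is in [S] for all positive [s] in [S] ([a_invariant_pseudo_frobenius]), and
    this forces [a = n] ([pseudo_frobenius]).

    The summands [R(i)_{>=0}] of the tilting object are graded submodules of
    [k[x, x^-1]], and maps of degree 0 between them are scalars, nonzero only when
    the set of degrees of the first is contained in that of the second. No nonzero
    map factors through a projective object, because a projective [R(-e)] has a
    gap in degree [e + n] while the summands have none above degree [n - 1]
    ([stab_cf]). So the algebra is the incidence algebra of a finite order
    ([Gamma_incidence]). By the symmetry of [S], the [i]-th summand is below the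
    [j]-th one exactly when [j - i] is in [S] or [j] is the last index, where the
    summand is [k[x]] ([Gamma_leE]).

    With the indices reversed, right modules over it are functors on [0..n], where
    0 is below everything and a positive [d] is below [d + s] for [s] in [S]. On
    the positive indices such a functor is a graded module over the polynomial
    ring [k[X, Y]], with [X] and [Y] of degrees [p] and [q], truncated in degrees
    at most [n]; the relation [X^q = Y^p] of [R], in degree [pq], is not felt. A
    functor is filtered by functors concentrated in one index, so by the horseshoe
    argument only these have to be resolved ([pd_le_of_simples]). At a positive
    index a truncated Koszul complex does it ([simp_pos_pd_le2]). At 0, the radical
    of the representable functor is a truncation of the maximal Cohen-Macaulay
    module [k[t]], which has projective dimension 1 over [k[X, Y]]
    ([simp0_pd_le2]). *)

Set Implicit Arguments.
Unset Strict Implicit.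
Unset Printing Implicit Defensive.

Import GRing.Theory Num.Theory.

Local Open Scope classical_set_scope.
Local Open Scope ring_scope.

(** * Submodules, extensions and projective dimension *)

Section Submodule.
Variables (A : pzRingType) (M : lmodType A) (P : submodClosed M).
Record submod := Submod { submod_val :> M; _ : submod_val \in P }.
HB.instance Definition _ := [isSub for submod_val].
HB.instance Definition _ := [Choice of submod by <:].
HB.instance Definition _ := [SubChoice_isSubLmodule of submod by <:].
End Submodule.

(** Submodules are only ever used through an injection with prescribed image;
    this keeps their carriers out of the statements below. *)
Lemma submodule_ex (A : pzRingType) (M : lmodType A) (P : M -> Prop) :
  P 0 -> (forall a x y, P x -> P y -> P (a *: x + y)) ->
  exists (K : lmodType A) (i : {linear K -> M}),
    injective i /\ forall y, P y <-> exists x, i x = y.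
Proof.
move=> P0 PL; pose p : {pred M} := fun x => `[< P x >].
have pc : submod_closed p.
  split; first exact/asboolP.
  by move=> a x y /asboolP Px /asboolP Py; apply/asboolP/PL.
pose S : submodClosed M := HB.pack p (GRing.isSubmodClosed.Build A M p pc).
exists (submod S), (val : {linear submod S -> M}); split.
  exact: val_inj.
move=> y; split=> [Py|[x <-]]; last by case: x => x /= /asboolP.
have yP : y \in S by apply/asboolP.
by exists (Submod yP).
Qed.

Section LinearMaps.
Variable A : pzRingType.

Lemma linear_ex (U V : lmodType A) (f : U -> V) :
  linear f -> exists h : {linear U -> V}, h =1 f.
Proof.
move=> fl.
pose h : {linear U -> V} := HB.pack f (GRing.isLinear.Build A U V *:%R f fl).
by exists h.
Qed.

Lemma kernel_ex (M N : lmodType A) (p : {linear M -> N}) :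
  exists (K : lmodType A) (i : {linear K -> M}),
    injective i /\ forall y, p y = 0 <-> exists x, i x = y.
Proof.
apply: submodule_ex; first exact: linear0.
by move=> a x y px py; rewrite linearP px py scaler0 addr0.
Qed.

Lemma linear_factor (K P X : lmodType A) (i : {linear K -> P})
    (f : {linear X -> P}) : injective i -> (forall x, exists y, i y = f x) ->
  exists g : {linear X -> K}, forall x, i (g x) = f x.
Proof.
move=> inj_i /choice[g gE]; have [|h hE] := @linear_ex X K g.
  by move=> a x y; apply: inj_i; rewrite linearP !gE linearP.
by exists h => x; rewrite hE.
Qed.

Lemma trivial_pd_le n (M : lmodType A) : (forall x : M, x = 0) -> pd_le n M.
Proof.
elim: n M => [|n IH] M M0 /=.
  move=> X Y g f _; have [|h hE] := @linear_ex M X (fun=> 0).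
    by move=> a x y; rewrite scaler0 addr0.
  by exists h => x; rewrite hE (M0 x) !linear0.
exists M, M, idfun, idfun; split=> //=; last exact: IH.
- move=> X Y g f _; have [|h hE] := @linear_ex M X (fun=> 0).
    by move=> a x y; rewrite scaler0 addr0.
  by exists h => x; rewrite hE (M0 x) !linear0.
- by move=> y; exists y.
- by move=> y; split=> // _; exists y.
Qed.

Lemma projective_pair (P Q : lmodType A) :
  projective_module P -> projective_module Q -> projective_module (P * Q)%type.
Proof.
move=> prP prQ X Y g f surjg.
have [|fP fPE] := @linear_ex P Y (fun x => f (x, 0)).
  move=> a x y; rewrite -linearP; congr (f _).
  by apply: injective_projections; rewrite /= ?scaler0 ?addr0.
have [|fQ fQE] := @linear_ex Q Y (fun x => f (0, x)).
  move=> a x y; rewrite -linearP; congr (f _).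
  by apply: injective_projections; rewrite /= ?scaler0 ?addr0.
have [hP hPE] := prP _ _ g fP surjg; have [hQ hQE] := prQ _ _ g fQ surjg.
have [|h hE] := @linear_ex (P * Q)%type X (fun z => hP z.1 + hQ z.2).
  by move=> a x y; rewrite /= !linearP scalerDr addrACA.
exists h => -[x y]; rewrite hE linearD /= hPE hQE fPE fQE -linearD.
by congr (f _); apply: injective_projections; rewrite /= ?addr0 ?add0r.
Qed.

Section Extension.
Variables (N M Q : lmodType A) (i : {linear N -> M}) (p : {linear M -> Q}).
Hypotheses (inj_i : injective i) (surj_p : Defs.surj p).
Hypothesis exact_ip : forall y, p y = 0 <-> exists x, i x = y.

(** A section [s] of [p] splits the sequence: [m - s (p m)] lies in [N], and the
    two parts of [m] are lifted separately. *)
Lemma projective_ext :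
  projective_module N -> projective_module Q -> projective_module M.
Proof.
move=> prN prQ X Y g f surjg.
have [s sE] := prQ _ _ p idfun surj_p.
have [|r rE] := @linear_ex M M (fun m => m - s (p m)).
  by move=> a x y; rewrite (linearP p) (linearP s) scalerBr opprD addrACA.
have [|t tE] := linear_factor (i := i) (f := r) inj_i.
  by move=> m; apply/exact_ip; rewrite rE linearB sE subrr.
have [h1 h1E] := prN _ _ g (f \o i) surjg.
have [h2 h2E] := prQ _ _ g (f \o s) surjg.
have [|h hE] := @linear_ex M X (fun m => h1 (t m) + h2 (p m)).
  by move=> a x y; rewrite !linearP /= scalerDr addrACA.
exists h => m; rewrite hE linearD /= h1E h2E /= tE rE -linearD.
by congr (f _); rewrite subrK.
Qed.

End Extension.

(** Horseshoe argument: a projective module mapping onto [Q] also maps to [M], so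
    that its direct sum with one mapping onto [N] maps onto [M]; the kernel of this map is an
    extension of the two kernels, which have smaller projective dimension. *)
Lemma pd_le_ext n (N M Q : lmodType A) (i : {linear N -> M})
    (p : {linear M -> Q}) : injective i -> Defs.surj p ->
  (forall y, p y = 0 <-> exists x, i x = y) ->
  pd_le n N -> pd_le n Q -> pd_le n M.
Proof.
elim: n N M Q i p => [|n IH] N M Q i p inj_i surj_p exact_ip.
  exact: projective_ext inj_i surj_p exact_ip.
move=> [PN [KN [iN [pN [prN injN surjN exN pdN]]]]].
move=> [PQ [KQ [iQ [pQ [prQ injQ surjQ exQ pdQ]]]]].
have [l lE] := prQ _ _ p pQ surj_p.
have [|P PE] := @linear_ex (PN * PQ)%type M (fun z => i (pN z.1) + l z.2).
  by move=> a x y; rewrite /= !linearP scalerDr addrACA.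
have [K [j [inj_j ex_j]]] := kernel_ex P.
exists (PN * PQ)%type, K, j, P; split=> //.
- exact: projective_pair.
- move=> m; have [y yE] := surjQ (p m).
  have /exact_ip[w wE] : p (m - l y) = 0 by rewrite linearB lE yE subrr.
  have [x xE] := surjN w; exists (x, y).
  by rewrite PE /= xE wE subrK.
have [|u uE] := @linear_ex KN (PN * PQ)%type (fun x => (iN x, 0)).
  move=> a x y; apply: injective_projections; rewrite /= ?linearP //.
  by rewrite scaler0 addr0.
have [|u' u'E] := linear_factor (i := j) (f := u) inj_j.
  move=> x; apply/ex_j; rewrite PE uE /= linear0 addr0.
  by have -> : pN (iN x) = 0 by [apply/exN; exists x]; rewrite linear0.
have [|v vE] := @linear_ex K PQ (fun z => (j z).2).
  by move=> a x y; rewrite linearP.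
have [|v' v'E] := linear_factor (i := iQ) (f := v) injQ.
  move=> z; apply/exQ; rewrite vE -lE.
  have : P (j z) = 0 by apply/ex_j; exists z.
  rewrite PE => /(congr1 p); rewrite linearD linear0.
  by have -> : p (i (pN (j z).1)) = 0 by [apply/exact_ip; eexists]; rewrite add0r.
apply: (IH KN K KQ u' v') => //.
- move=> x y /(congr1 j); rewrite !u'E !uE => /(congr1 fst) /=; exact: injN.
- move=> z.
  have : p (l (iQ z)) = 0 by rewrite lE; apply/exQ; exists z.
  move=> /exact_ip[w wE]; have [x xE] := surjN w.
  have /ex_j[t tE] : P (- x, iQ z) = 0.
    by rewrite PE /= linearN linearN /= xE wE addNr.
  by exists t; apply: injQ; rewrite v'E vE tE.
- move=> z; split=> [vz|[x <-]].
    have jz2 : (j z).2 = 0 by rewrite -vE -v'E vz linear0.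
    have : P (j z) = 0 by apply/ex_j; exists z.
    rewrite PE jz2 linear0 addr0 -(linear0 i) => /inj_i/exN[x xE].
    exists x; apply: inj_j; rewrite u'E uE.
    by apply: injective_projections.
  by apply: injQ; rewrite v'E vE u'E uE linear0.
Qed.

End LinearMaps.

Section VectorSpaces.
Variables (k : fieldType) (V M N : lmodType k).
Variables (g : {linear M -> N}) (f : {linear V -> N}).

(** A linear lift of [f] through [g] defined on a subspace, given by its graph.
    The empty relation qualifies, as Zorn's lemma asks of the union of the empty
    chain. *)
Definition partial_lift (G : set (V * M)%type) : Prop :=
  [/\ forall (a : k) x y, G x -> G y -> G (a *: x + y),
      forall m, G (0, m) -> m = 0 &
      forall z, G z -> g z.2 = f z.1].

Lemma partial_lift_bigcup (F : set (set (V * M))) :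
  F `<=` partial_lift -> total_on F subset ->
  partial_lift (\bigcup_(X in F) X).
Proof.
move=> FP Ft; split.
- move=> a x y [X FX Xx] [Y FY Yy].
  have [XY|YX] := Ft _ _ FX FY.
    by exists Y => //; have [PL _ _] := FP _ FY; apply: PL => //; apply: XY.
  by exists X => //; have [PL _ _] := FP _ FX; apply: PL => //; apply: YX.
- by move=> m [X FX Xm]; have [_ P0 _] := FP _ FX; apply: P0.
- by move=> z [X FX Xz]; have [_ _ PE] := FP _ FX; apply: PE.
Qed.

Definition extend_lift (G : set (V * M)) (w : V * M) : set (V * M) :=
  [set z | exists a : k, z = a *: w \/ exists2 t, G t & z = a *: w + t].

Lemma partial_lift_extend G (w : V * M) :
  partial_lift G -> g w.2 = f w.1 -> w.1 != 0 ->
  (forall m, ~ G (w.1, m)) -> partial_lift (extend_lift G w).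
Proof.
move=> [GL G0 GE] wE w0 wG.
have GZ (c : k) t : G t -> G (c *: t).
  move=> Gt; have Z : G 0 by have := GL (-1) _ _ Gt Gt; rewrite scaleN1r addNr.
  by have := GL c _ _ Gt Z; rewrite addr0.
split.
- move=> c x y [a Hx] [b Hy]; exists (c * a + b).
  case: Hx => [->|[t Gt ->]]; case: Hy => [->|[t' Gt' ->]].
  + by left; rewrite scalerDl scalerA.
  + by right; exists t' => //; rewrite scalerDl scalerA addrA.
  + right; exists (c *: t); first exact: GZ.
    by rewrite scalerDl scalerDr scalerA addrAC.
  + right; exists (c *: t + t'); first exact: GL.
    by rewrite scalerDl scalerDr scalerA addrACA.
- move=> m [a [E|[t Gt E]]].
    have /esym/eqP := congr1 fst E; rewrite /= scaler_eq0 (negPf w0) orbF => /eqP a0.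
    by have := congr1 snd E; rewrite /= a0 scale0r.
  have [a0|a0] := eqVneq a 0.
    by apply: G0; rewrite E a0 scale0r add0r.
  (* solving for w in the relation exhibits a lift of w.1 already in G *)
  case: (wG (- (a^-1 *: t).2)).
  have := GZ (- a^-1) _ Gt; rewrite scaleNr.
  suff -> : - (a^-1 *: t) = (w.1, - (a^-1 *: t).2) by [].
  apply: injective_projections => //=.
  have /esym/eqP := congr1 fst E; rewrite /= addrC addr_eq0 => /eqP ->.
  by rewrite scalerN opprK scalerA mulVf // scale1r.
- move=> z [a [->|[t Gt ->]]] /=; first by rewrite !linearZ wE.
  by rewrite !linearP wE GE.
Qed.

End VectorSpaces.

(** The vector spaces below need not be finite dimensional, so a maximal partial
    lift is provided by Zorn's lemma; on a vector outside of its domain it could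
    be extended by any preimage. *)
Lemma vector_space_projective (k : fieldType) (V : lmodType k) :
  projective_module V.
Proof.
move=> M N g f surjg.
have [G [GP Gmax]] :=
  Zorn_bigcup (@partial_lift_bigcup k V M N g f).
have [GL G0 GE] := GP.
have tot v : exists m, G (v, m).
  have [v0|v0] := eqVneq v 0.
    rewrite v0; have [[z Gz]|none] := pselect (exists z, G z).
      by exists 0; have := GL (-1) _ _ Gz Gz; rewrite scaleN1r addNr.
    (* the empty relation is not maximal: the zero relation contains it *)
    case: (Gmax [set 0]); first split.
    - by move=> z Gz; case: none; exists z.
    - by move=> /(_ 0 erefl) Gz; case: none; exists 0.
    split.
    - by move=> a x y -> ->; rewrite scaler0 addr0.
    - by move=> m [].
    - by move=> z ->; rewrite !linear0.
  apply: contrapT => none; have [m mE] := surjg (f v).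
  have Gw u : ~ G ((v, m).1, u) by move=> Gu; apply: none; exists u.
  case: (Gmax (extend_lift G (v, m))); first split.
  - by move=> z Gz; exists 0; right; exists z => //; rewrite scale0r add0r.
  - move=> H; apply: (Gw m); apply: H.
    by exists 1; left; rewrite scale1r.
  - exact: partial_lift_extend.
have /choice[h hG] := tot.
have [|l lE] := @linear_ex k V M h.
  move=> a x y; apply/eqP; rewrite -subr_eq0; apply/eqP/G0.
  have := GL (-1) _ _ (GL a _ _ (hG x) (hG y)) (hG (a *: x + y)).
  suff -> : -1 *: (a *: (x, h x) + (y, h y)) + (a *: x + y, h (a *: x + y)) =
    (0, h (a *: x + y) - (a *: h x + h y)) by [].
  by rewrite scaleN1r addrC; apply: injective_projections; rewrite /= ?subrr.
by exists l => v; rewrite lE; apply: GE (hG v).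
Qed.

(** * Incidence rings *)

(** Coordinates identifying [B] with the incidence algebra of the order [le]
    over [k]: [ico b i j] is the matrix entry of [b] from [i] to [j], and [iE]
    gives the multiples of the matrix units. In a product the right factor acts
    first, so that a left [B]-module [M] is a covariant functor [i |-> M_i] from
    the order to vector spaces, where [M_i] is the image of [iE i i 1].
    Reflexivity and transitivity of [le] follow from the ring structure. *)
Record incidence (k : fieldType) (I : finType) (le : rel I) (B : pzRingType) :=
  Incidence {
  ico : B -> I -> I -> k;
  iE : I -> I -> k -> B;
  ile_anti : antisymmetric le;
  icoD : forall b b' i j, ico (b + b') i j = ico b i j + ico b' i j;
  icoM : forall b b' i j, ico (b * b') i j = \sum_l ico b' i l * ico b l j;
  ico1 : forall i j, ico 1 i j = (i == j)%:R;
  ico_le : forall b i j, ico b i j != 0 -> le i j;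
  ico_inj : forall b b', (forall i j, ico b i j = ico b' i j) -> b = b';
  icoE : forall i j c, le i j ->
    forall i' j', ico (iE i j c) i' j' = c *+ ((i' == i) && (j' == j))
}.

Section Carriers.
Variables (k : fieldType) (I : finType) (le : rel I) (B : pzRingType).
(** The argument [D] lets the module structures put on these carriers below, which
    depend on it, be inferred from the type: restriction of scalars to [k], the
    constant functor with value [V^T], and the functor equal to [V] at [d] and to
    0 elsewhere. *)
Definition scalar_restriction (D : incidence k le B) (M : lmodType B) : Type := M.
Definition constant_module (D : incidence k le B) (T : finType) (V : lmodType k) : Type :=
  {ffun I * T -> V}.
Definition simple_module (D : incidence k le B) (d : I) (V : lmodType k) : Type := V.
End Carriers.

Section Incidence.
Variables (k : fieldType) (I : finType) (le : rel I) (B : pzRingType).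
Variable D : incidence k le B.
Local Notation co := (ico D).
Local Notation E := (iE D).

Lemma ile_refl i : le i i.
Proof. by apply: (ico_le (i0 := D) (b := 1)); rewrite ico1 eqxx oner_eq0. Qed.

Lemma ico0 i j : co 0 i j = 0.
Proof. by apply: (addrI (co 0 i j)); rewrite -icoD !addr0. Qed.

Lemma ico_sum (T : Type) (s : seq T) (P : pred T) (F : T -> B) i j :
  co (\sum_(t <- s | P t) F t) i j = \sum_(t <- s | P t) co (F t) i j.
Proof.
by apply: (big_morph (fun b => co b i j)) => [b b'|]; rewrite ?icoD ?ico0.
Qed.

Lemma iE0 i j : le i j -> E i j 0 = 0.
Proof. by move=> ij; apply: (ico_inj (i0 := D)) => u v; rewrite ico0 icoE // mul0rn. Qed.

Lemma mul_iE b i j c : le i j ->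
  b * E i j c = \sum_(l | le i l) E i l (co b j l * c).
Proof.
move=> ij; apply: (ico_inj (i0 := D)) => u v; rewrite icoM ico_sum.
rewrite (bigD1 j) //= big1 ?addr0; last first.
  by move=> l lj; rewrite icoE // (negPf lj) andbF mul0r.
rewrite icoE // eqxx andbT; have [->|ui] := eqVneq u i; last first.
  by rewrite mul0r big1 // => l il; rewrite icoE // (negPf ui).
have [iv|niv] := boolP (le i v).
  rewrite (bigD1 v) //= big1 ?addr0; last first.
    by move=> l /andP[il lv]; rewrite icoE // eq_sym (negPf lv) andbF.
  by rewrite icoE // !eqxx mulrC.
rewrite big1; last first.
  move=> l il; rewrite icoE //; have [vl|] := eqVneq v l; last by rewrite andbF.
  by case/negP: niv; rewrite vl.
have [->|/(ico_le (i0 := D)) jv] := eqVneq (co b j v) 0; first by rewrite mulr0.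
have := ico_le (i0 := D) (b := E j v 1 * E i j 1) (i := i) (j := v).
rewrite icoM (bigD1 j) //= big1 ?addr0; last first.
  by move=> l lj; rewrite icoE // (negPf lj) andbF mul0r.
rewrite !icoE // !eqxx mulr1 oner_eq0 => /(_ isT) iv.
by case/negP: niv.
Qed.

Lemma iE_mul b i j c : le i j ->
  E i j c * b = \sum_(l | le l j) E l j (c * co b l i).
Proof.
move=> ij; apply: (ico_inj (i0 := D)) => u v; rewrite icoM ico_sum.
rewrite (bigD1 i) //= big1 ?addr0; last first.
  by move=> l li; rewrite icoE // (negPf li) mulr0.
rewrite icoE // eqxx /=; have [->|vj] := eqVneq v j; last first.
  by rewrite mulr0 big1 // => l lj; rewrite icoE // (negPf vj) andbF.
have [uj|nuj] := boolP (le u j).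
  rewrite (bigD1 u) //= big1 ?addr0; last first.
    by move=> l /andP[lj lu]; rewrite icoE // eq_sym (negPf lu).
  by rewrite icoE // !eqxx mulrC.
rewrite big1; last first.
  move=> l lj; rewrite icoE //; have [ul|] := eqVneq u l; last by rewrite andFb.
  by case/negP: nuj; rewrite ul.
have [->|/(ico_le (i0 := D)) ui] := eqVneq (co b u i) 0; first by rewrite mul0r.
have := ico_le (i0 := D) (b := E i j 1 * E u i 1) (i := u) (j := j).
rewrite icoM (bigD1 i) //= big1 ?addr0; last first.
  by move=> l li; rewrite icoE // (negPf li) andbF mul0r.
rewrite !icoE // !eqxx mulr1 oner_eq0 => /(_ isT) uj.
by case/negP: nuj.
Qed.

Lemma iEM i j l c c' : le i j -> le j l -> E j l c' * E i j c = E i l (c' * c).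
Proof.
move=> ij jl; rewrite mul_iE //.
have il : le i l.
  apply: (ico_le (i0 := D) (b := E j l 1 * E i j 1)).
  rewrite icoM (bigD1 j) //= big1 ?addr0; last first.
    by move=> m mj; rewrite icoE // (negPf mj) andbF mul0r.
  by rewrite !icoE // !eqxx mulr1 oner_eq0.
rewrite (bigD1 l) //= big1 ?addr0 => [|m /andP[im ml]].
  by rewrite icoE // !eqxx.
by rewrite icoE // (negPf ml) andbF mul0r iE0.
Qed.

(** The scalar matrices, through which [k] acts on every [B]-module. *)
Definition iscal (c : k) : B := \sum_i E i i c.

Lemma ico_iscal c i j : co (iscal c) i j = c *+ (i == j).
Proof.
rewrite ico_sum (bigD1 i) //= big1 ?addr0 => [|l li].
  by rewrite icoE ?ile_refl // eqxx /= eq_sym.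
by rewrite icoE ?ile_refl // eq_sym (negPf li).
Qed.

Lemma iscal1 : iscal 1 = 1.
Proof. by apply: (ico_inj (i0 := D)) => i j; rewrite ico_iscal ico1. Qed.

Lemma iscalD c c' : iscal (c + c') = iscal c + iscal c'.
Proof.
by apply: (ico_inj (i0 := D)) => i j; rewrite icoD !ico_iscal mulrnDl.
Qed.

Lemma iscalM c c' : iscal (c * c') = iscal c * iscal c'.
Proof.
apply: (ico_inj (i0 := D)) => i j; rewrite icoM (bigD1 i) //= big1 ?addr0.
  by rewrite !ico_iscal eqxx mulr1n mulrnAr mulrC.
by move=> l li; rewrite ico_iscal eq_sym (negPf li) mul0r.
Qed.

Lemma iE_iscal i j c c' : le i j -> E i j c * iscal c' = E i j (c * c').
Proof.
move=> ij; rewrite iE_mul // (bigD1 i) //= big1 ?addr0 => [|l /andP[lj li]].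
  by rewrite ico_iscal eqxx.
by rewrite ico_iscal (negPf li) mulr0 iE0.
Qed.

Lemma iscal_iE i j c c' : le i j -> iscal c * E i j c' = E i j (c * c').
Proof.
move=> ij; rewrite mul_iE // (bigD1 j) //= big1 ?addr0 => [|l /andP[lj li]].
  by rewrite ico_iscal eqxx.
by rewrite ico_iscal eq_sym (negPf li) mul0r iE0.
Qed.

Section Restriction.
Variable M : lmodType B.

Local Notation resc := (scalar_restriction D M).
HB.instance Definition _ := GRing.Zmodule.on resc.

Definition resc_scale (c : k) (x : resc) : resc := iscal c *: (x : M).

Fact resc_scaleA c d x : resc_scale c (resc_scale d x) = resc_scale (c * d) x.
Proof. by rewrite /resc_scale scalerA iscalM. Qed.
Fact resc_scale1 : left_id 1 resc_scale.
Proof. by move=> x; rewrite /resc_scale iscal1 scale1r. Qed.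
Fact resc_scaleDr : right_distributive resc_scale +%R.
Proof. by move=> c x y; apply: scalerDr. Qed.
Fact resc_scaleDl x : {morph resc_scale^~ x : c d / c + d}.
Proof. by move=> c d; rewrite /resc_scale iscalD scalerDl. Qed.

HB.instance Definition _ := GRing.Zmodule_isLmodule.Build k resc
  resc_scaleA resc_scale1 resc_scaleDr resc_scaleDl.

Lemma linear_resc (V : lmodType k) (h : {linear V -> resc}) c v :
  (h (c *: v) : M) = iscal c *: (h v : M).
Proof. by rewrite linearZ. Qed.

End Restriction.

Section Constant.
Variables (T : finType) (V : lmodType k).

Local Notation cst := (constant_module D T V).
HB.instance Definition _ := GRing.Zmodule.on cst.

Definition cst_scale (b : B) (x : cst) : cst :=
  [ffun z : I * T => \sum_i co b i z.1 *: (x : {ffun _ -> _}) (i, z.2)].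

Fact cst_scaleA b b' x : cst_scale b (cst_scale b' x) = cst_scale (b * b') x.
Proof.
apply/ffunP => -[j t]; rewrite !ffunE /=.
under eq_bigr => i _ do rewrite ffunE scaler_sumr /=.
rewrite exchange_big; apply: eq_bigr => l _; rewrite icoM scaler_suml.
by apply: eq_bigr => i _; rewrite scalerA mulrC.
Qed.
Fact cst_scale1 : left_id 1 cst_scale.
Proof.
move=> x; apply/ffunP => -[j t]; rewrite ffunE (bigD1 j) //= big1 ?addr0.
  by rewrite ico1 eqxx scale1r.
by move=> i ij; rewrite ico1 (negPf ij) scale0r.
Qed.
Fact cst_scaleDr : right_distributive cst_scale +%R.
Proof.
move=> b x y; apply/ffunP => z; rewrite !ffunE -big_split.
by apply: eq_bigr => i _; rewrite ffunE scalerDr.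
Qed.
Fact cst_scaleDl x : {morph cst_scale^~ x : b b' / b + b'}.
Proof.
move=> b b'; apply/ffunP => z; rewrite !ffunE -big_split.
by apply: eq_bigr => i _; rewrite icoD scalerDl.
Qed.

HB.instance Definition _ := GRing.Zmodule_isLmodule.Build B cst
  cst_scaleA cst_scale1 cst_scaleDr cst_scaleDl.

Definition cst_at (x : cst) (i : I) (t : T) : V := (x : {ffun _ -> _}) (i, t).

Lemma cst_eq (x y : cst) : (forall i t, cst_at x i t = cst_at y i t) -> x = y.
Proof. by move=> xy; apply/ffunP => -[i t]; apply: xy. Qed.

Lemma cst_atD x y i t : cst_at (x + y) i t = cst_at x i t + cst_at y i t.
Proof. by rewrite /cst_at ffunE. Qed.

Lemma cst_at0 i t : cst_at 0 i t = 0.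
Proof. by rewrite /cst_at ffunE. Qed.

Lemma cst_atZ b x j t : cst_at (b *: x) j t = \sum_i co b i j *: cst_at x i t.
Proof. by rewrite /cst_at ffunE. Qed.

Lemma cst_at_sum (J : Type) (s : seq J) (P : pred J) (F : J -> cst) i t :
  cst_at (\sum_(m <- s | P m) F m) i t = \sum_(m <- s | P m) cst_at (F m) i t.
Proof.
by apply: (big_morph (fun x => cst_at x i t)) => [x y|]; rewrite ?cst_atD ?cst_at0.
Qed.

Definition cst_of (F : I -> T -> V) : cst := [ffun z => F z.1 z.2].

Lemma cst_ofE F i t : cst_at (cst_of F) i t = F i t.
Proof. by rewrite /cst_at ffunE. Qed.

(** All modules of the resolutions are subfunctors of constant functors, cut out
    by one up-set [U t] for each coordinate [t]. *)
Definition supported (U : T -> pred I) (x : cst) :=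
  forall n t, cst_at x n t != 0 -> U t n.

Lemma supported_submodule (U : T -> pred I) :
  (forall t i j, U t i -> le i j -> U t j) ->
  exists (K : lmodType B) (i : {linear K -> cst}),
    injective i /\ forall y, supported U y <-> exists x, i x = y.
Proof.
move=> Uup; apply: submodule_ex; first by move=> n t; rewrite cst_at0 eqxx.
move=> b x y Ux Uy n t; rewrite cst_atD cst_atZ; apply: contraR => nU.
have -> : cst_at y n t = 0 by apply/eqP; apply: contraNT nU; apply: Uy.
rewrite addr0 big1 // => i _.
have [->|xi] := eqVneq (cst_at x i t) 0; first by rewrite scaler0.
have [->|/(ico_le (i0 := D)) bi] := eqVneq (co b i n) 0; first by rewrite scale0r.
by case/negP: nU; apply: Uup bi; apply: Ux.
Qed.

End Constant.

(** For [U t] the up-set of [d], the [t]-th coordinates form the representable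
    functor at [d] tensored with [V]. By the Yoneda lemma a map out of it is a
    linear map on [V], evaluated at [d], and linear maps can be lifted since [V]
    is a vector space. Empty up-sets contribute nothing. *)
Lemma supported_projective (T : finType) (V : lmodType k) (U : T -> pred I)
    (K : lmodType B) (i : {linear K -> constant_module D T V}) :
  injective i -> (forall y, supported U y <-> exists x, i x = y) ->
  (forall t, (exists d, U t =1 le d) \/ U t =1 pred0) ->
  projective_module K.
Proof.
move=> inj_i imi Upr M N g f surjg.
have /choice[o oP] t :
    exists o : option I, forall n, U t n = if o is Some d then le d n else false.
  by case: (Upr t) => [[d dP]|U0]; [exists (Some d)|exists None].
(* e t v is the vector v placed at the bottom of the t-th up-set *)
pose e t v : constant_module D T V := cst_of (fun n s =>
  if o t is Some d then v *+ ((n == d) && (s == t)) else 0).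
have eP t v : exists x, i x = e t v.
  apply/imi => n s; rewrite cst_ofE; case ot: (o t) => [d|]; last by rewrite eqxx.
  have [->|_] := eqVneq n d; last by rewrite eqxx.
  have [->|_] := eqVneq s t; last by rewrite eqxx.
  by move=> _; rewrite oP ot ile_refl.
have /choice[w wE] t : exists w : V -> K, forall v, i (w v) = e t v.
  by have /choice[w wE] := eP t; exists w.
have /choice[h hE] t :
    exists h : {linear V -> scalar_restriction D M}, forall v, g (h v : M) = f (w t v).
  have [|g' g'E] := @linear_ex k (scalar_restriction D M) (scalar_restriction D N) g.
    by move=> c x y; rewrite -[c *: x]/(iscal c *: (x : M)) linearP.
  have [|f' f'E] := @linear_ex k V (scalar_restriction D N) (fun v => f (w t v)).
    move=> c x y; rewrite -[c *: (_ : scalar_restriction D N)]/(iscal c *: (f (w t x) : N)).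
    rewrite -linearP; congr (f _); apply: inj_i; rewrite linearP !wE.
    apply: cst_eq => n s; rewrite cst_atD cst_atZ (bigD1 n) //= big1 ?addr0.
      rewrite ico_iscal eqxx !cst_ofE; case: (o t) => [d|]; last first.
        by rewrite scaler0 addr0.
      by rewrite -scalerMnr -mulrnDl.
    by move=> l ln; rewrite ico_iscal (negPf ln) scale0r.
  have [|h hE] := @vector_space_projective k V _ _ g' f'.
    by move=> y; have [x xE] := surjg y; exists x; rewrite g'E.
  by exists h => v; rewrite -f'E -hE g'E.
pose u t n : B := if o t is Some d then E d n 1 else 0.
have [|h' h'E] := @linear_ex B K M
    (fun x => \sum_t \sum_(n | U t n) u t n *: (h t (cst_at (i x) n t) : M)).
  move=> b x y; rewrite scaler_sumr -big_split; apply: eq_bigr => t _ /=.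
  rewrite /u; case ot: (o t) => [d|]; last first.
    by rewrite !big1 ?scaler0 ?addr0 // => n _; rewrite scale0r.
  have Ud n : U t n = le d n by rewrite oP ot.
  rewrite scaler_sumr.
  under eq_bigr => n Un do
    rewrite linearP cst_atD cst_atZ linearD linear_sum /= scalerDr scaler_sumr.
  rewrite big_split /=; congr (_ + _).
  rewrite exchange_big [RHS]big_mkcond /=; apply: eq_bigr => l _.
  case: ifP => [Ul|/negbT nUl]; last first.
    have -> : cst_at (i x) l t = 0.
      by apply/eqP; apply: contraNT nUl; apply: ((imi (i x)).2 (ex_intro _ x erefl)).
    by rewrite big1 // => n _; rewrite scaler0 linear0 scaler0.
  rewrite scalerA mul_iE -?Ud // scaler_suml.
  rewrite (eq_bigl (le d)) //; apply: eq_bigr => n dn.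
  by rewrite linear_resc scalerA iE_iscal // mul1r mulr1.
exists h' => x; rewrite h'E linear_sum.
rewrite -[RHS](congr1 f (_ : \sum_t \sum_(n | U t n) u t n *: w t (cst_at (i x) n t) = x)).
  rewrite linear_sum; apply: eq_bigr => t _; rewrite !linear_sum.
  by apply: eq_bigr => n _; rewrite !linearZ /= hE.
apply: inj_i; apply: cst_eq => m s; rewrite linear_sum cst_at_sum.
have us t n : U t n -> cst_at (i (u t n *: w t (cst_at (i x) n t))) m s =
    cst_at (i x) n t *+ ((n == m) && (t == s)).
  rewrite linearZ /= wE cst_atZ /u oP; case ot: (o t) => [d|] // dn.
  rewrite (bigD1 d) //= big1 ?addr0 => [|l ld]; last first.
    by rewrite icoE // (negPf ld) scale0r.
  rewrite icoE // cst_ofE ot !eqxx /= eq_sym [s == t]eq_sym.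
  by case: (n == m); case: (t == s); rewrite ?scale1r ?scale0r.
rewrite [LHS](bigD1 s) //= [X in _ + X]big1 ?addr0 => [|t ts]; last first.
  rewrite linear_sum cst_at_sum big1 // => n Un.
  by rewrite us // (negPf ts) andbF.
rewrite linear_sum cst_at_sum; have [Um|nUm] := boolP (U s m).
  rewrite (bigD1 m) //= big1 ?addr0 => [|n /andP[Un nm]].
    by rewrite us // !eqxx.
  by rewrite us // (negPf nm).
have -> : cst_at (i x) m s = 0.
  by apply/eqP; apply: contraNT nUm; apply: ((imi (i x)).2 (ex_intro _ x erefl)).
apply: big1 => n Un; rewrite us //; have [nm|] := eqVneq n m; last by [].
by case/negP: nUm; rewrite -nm.
Qed.

Section Simple.
Variables (d : I) (V : lmodType k).

Local Notation simp := (simple_module D d V).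
HB.instance Definition _ := GRing.Zmodule.on simp.

Definition simp_scale (b : B) (x : simp) : simp := co b d d *: (x : V).

Fact simp_scaleA b c x : simp_scale b (simp_scale c x) = simp_scale (b * c) x.
Proof.
rewrite /simp_scale scalerA icoM (bigD1 d) //= big1 ?addr0 1?mulrC // => l ld.
have [->|/(ico_le (i0 := D)) dl] := eqVneq (co c d l) 0; first by rewrite mul0r.
have [->|/(ico_le (i0 := D)) ld'] := eqVneq (co b l d) 0; first by rewrite mulr0.
by case/eqP: ld; apply: (ile_anti D); rewrite dl ld'.
Qed.
Fact simp_scale1 : left_id 1 simp_scale.
Proof. by move=> x; rewrite /simp_scale ico1 eqxx scale1r. Qed.
Fact simp_scaleDr : right_distributive simp_scale +%R.
Proof. by move=> b x y; apply: scalerDr. Qed.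
Fact simp_scaleDl x : {morph simp_scale^~ x : b c / b + c}.
Proof. by move=> b c; rewrite /simp_scale icoD scalerDl. Qed.

HB.instance Definition _ := GRing.Zmodule_isLmodule.Build B simp
  simp_scaleA simp_scale1 simp_scaleDr simp_scaleDl.

Lemma simp_scaleE (b : B) (x : simp) : b *: x = co b d d *: (x : V) :> V.
Proof. by []. Qed.

End Simple.

End Incidence.

Section Filtration.
Variables (k : fieldType) (N : nat) (le : rel 'I_N) (B : pzRingType).
Variable D : incidence k le B.
Local Notation co := (ico D).
Local Notation E := (iE D).
Hypothesis le_leq : forall i j, le i j -> (i <= j)%N.

(** Removing the indices one at a time from the bottom filters any module by
    modules concentrated in a single index. *)
Lemma pd_le_of_simples m :
  (forall d (V : lmodType k), pd_le m (simple_module D d V)) ->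
  forall M : lmodType B, pd_le m M.
Proof.
move=> pd_simp.
suff pdr r (M : lmodType B) :
    (forall (j : 'I_N) (x : M), (j + r < N)%N -> E j j 1 *: x = 0) -> pd_le m M.
  by move=> M; apply: (pdr N) => j x; rewrite addnC ltnNge leq_addr.
elim: r M => [|r IH] M M0.
  apply: trivial_pd_le => x; rewrite -[x]scale1r -(iscal1 D) scaler_suml.
  by rewrite big1 // => j _; rewrite M0 // addn0.
have [Nr|rN] := leqP N r.
  by apply: IH => j x; lia.
have dN : (N - r.+1 < N)%N by lia.
pose d := Ordinal dN.
have dd := ile_refl D d.
(* no index below d carries anything, so only the diagonal entry of b survives *)
have Ed (b : B) (x : M) : E d d 1 *: (b *: x) = iscal D (co b d d) *: (E d d 1 *: x).
  rewrite !scalerA iE_mul // scaler_suml (bigD1 d) //= big1 ?addr0.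
    by rewrite iscal_iE // mul1r mulr1.
  move=> l /andP[ld nld]; rewrite mul1r.
  have lt_ld : (l < d)%N by rewrite ltn_neqAle le_leq // andbT; apply: contra nld => /eqP/val_inj ->.
  rewrite -[co b l d]mulr1 -(iEM D _ _ (ile_refl D l) ld).
  by rewrite -scalerA M0 ?scaler0 //; move: lt_ld => /=; lia.
have [M' [i [inj_i iM']]] : exists (K : lmodType B) (i : {linear K -> M}),
    injective i /\ forall y, E d d 1 *: y = 0 <-> exists x, i x = y.
  apply: submodule_ex; first by rewrite scaler0.
  by move=> b x y x0 y0; rewrite scalerDr Ed x0 y0 scaler0 addr0.
have [V [j [inj_j jV]]] : exists (V : lmodType k) (j : {linear V -> scalar_restriction D M}),
    injective j /\ forall y, E d d 1 *: (y : M) = y <-> exists x, j x = y.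
  apply: submodule_ex; first by rewrite scaler0.
  move=> c x y xE yE; rewrite -[c *: x]/(iscal D c *: (x : M)) scalerDr yE.
  by rewrite scalerA iE_iscal // mul1r -[X in _ = iscal D c *: X + _]xE scalerA
    iscal_iE // mulr1.
have /choice[q qE] x : exists v, j v = E d d 1 *: (x : M).
  by apply/jV; rewrite scalerA iEM // mulr1.
have [|p pE] := @linear_ex B M (simple_module D d V) q.
  move=> b x y; apply: inj_j; rewrite qE scalerDr Ed simp_scaleE raddfD /=.
  by rewrite linear_resc !qE.
apply: (pd_le_ext (i := i) (p := p)) => //.
- by move=> v; exists (j v); rewrite pE; apply: inj_j; rewrite qE; apply/jV; exists v.
- move=> y; rewrite pE -iM'; split=> [y0|y0]; first by rewrite -qE y0 linear0.
  by apply: inj_j; rewrite qE y0 linear0.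
- apply: IH => l x lr; apply: inj_i; rewrite linearZ linear0 /=.
  have [ld|ld] := eqVneq l d; first by rewrite ld; apply/iM'; exists x.
  apply: M0; have : (l : nat) != d by apply: contra ld => /eqP/val_inj ->.
  by move=> /=; lia.
Qed.

End Filtration.

(** * Resolutions by families of subspaces *)

Section SupportedResolutions.
Variables (k : fieldType) (I : finType) (le : rel I) (B : pzRingType).
Variable D : incidence k le B.
Local Notation co := (ico D).
Variable V : lmodType k.

Definition is_supp (T : finType) (U : T -> pred I) (K : lmodType B)
    (i : {linear K -> constant_module D T V}) : Prop :=
  injective i /\ forall y, supported U y <-> exists x, i x = y.

(** A matrix of scalars acts on the coordinates [T], commuting with [B], which
    acts on the indices [I]. *)
Lemma cst_map_ex (T T' : finType) (m : T -> T' -> k) :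
  exists h : {linear constant_module D T V -> constant_module D T' V},
    forall x n t, cst_at (h x) n t = \sum_s m s t *: cst_at x n s.
Proof.
have [|h hE] := @linear_ex B (constant_module D T V) (constant_module D T' V)
    (fun x => cst_of D (fun n t => \sum_s m s t *: cst_at x n s)).
  move=> b x y; apply: cst_eq => n t; rewrite cst_atD cst_atZ !cst_ofE.
  under eq_bigr => s _ do rewrite cst_atD cst_atZ scalerDr scaler_sumr.
  rewrite big_split /= exchange_big /=; congr (_ + _); apply: eq_bigr => l _.
  rewrite cst_ofE scaler_sumr; apply: eq_bigr => s _.
  by rewrite !scalerA mulrC.
by exists h => x n t; rewrite hE cst_ofE.
Qed.

Lemma is_supp_map (T T' : finType) (U : T -> pred I) (U' : T' -> pred I)
    (K K' : lmodType B) (i : {linear K -> constant_module D T V})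
    (i' : {linear K' -> constant_module D T' V}) (m : T -> T' -> k) :
  is_supp U i -> is_supp U' i' ->
  (forall n (x : T -> V), (forall s, x s != 0 -> U s n) ->
     forall t, \sum_s m s t *: x s != 0 -> U' t n) ->
  exists g : {linear K -> K'},
    forall x n t, cst_at (i' (g x)) n t = \sum_s m s t *: cst_at (i x) n s.
Proof.
move=> [inj_i imi] [inj_i' imi'] mU; have [h hE] := cst_map_ex m.
have [|g gE] := linear_factor (i := i') (f := h \o i) inj_i'.
  move=> x; apply/imi' => n t; rewrite hE; apply: mU => s.
  by apply: ((imi (i x)).2 (ex_intro _ x erefl)).
by exists g => x n t; rewrite gE /= hE.
Qed.

(** A short exact sequence of supported families whose maps are given by scalar
    matrices on the coordinates may be checked at each index [n] separately. *)
Lemma is_supp_pd_le1 (T0 T1 T2 : finType) (U0 : T0 -> pred I)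
    (U1 : T1 -> pred I) (U2 : T2 -> pred I) (K0 K1 K2 : lmodType B)
    (i0 : {linear K0 -> constant_module D T0 V}) (i1 : {linear K1 -> constant_module D T1 V})
    (i2 : {linear K2 -> constant_module D T2 V})
    (m : T1 -> T0 -> k) (m' : T2 -> T1 -> k) :
  is_supp U0 i0 -> is_supp U1 i1 -> is_supp U2 i2 ->
  projective_module K1 -> projective_module K2 ->
  (forall n (x : T1 -> V), (forall s, x s != 0 -> U1 s n) ->
     forall t, \sum_s m s t *: x s != 0 -> U0 t n) ->
  (forall n (y : T2 -> V), (forall s, y s != 0 -> U2 s n) ->
     forall t, \sum_s m' s t *: y s != 0 -> U1 t n) ->
  (forall n (z : T0 -> V), (forall s, z s != 0 -> U0 s n) ->
     exists2 x : T1 -> V, forall s, x s != 0 -> U1 s n &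
       forall t, \sum_s m s t *: x s = z t) ->
  (forall n (y : T2 -> V), (forall s, y s != 0 -> U2 s n) ->
     (forall t, \sum_s m' s t *: y s = 0) -> forall s, y s = 0) ->
  (forall n (x : T1 -> V), (forall s, x s != 0 -> U1 s n) ->
     (forall t, \sum_s m s t *: x s = 0) <->
     exists2 y : T2 -> V, forall s, y s != 0 -> U2 s n &
       forall t, \sum_s m' s t *: y s = x t) ->
  pd_le 1 K0.
Proof.
move=> s0 s1 s2 pr1 pr2 mU mU' m_surj m_inj m_exact.
have [g gE] := is_supp_map s1 s0 mU; have [g' g'E] := is_supp_map s2 s1 mU'.
have [inj0 im0] := s0; have [inj1 im1] := s1; have [inj2 im2] := s2.
have sup0 x : supported U0 (i0 x) by apply/im0; exists x.
have sup1 x : supported U1 (i1 x) by apply/im1; exists x.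
have sup2 x : supported U2 (i2 x) by apply/im2; exists x.
exists K1, K2, g', g; split=> //.
- move=> x y xy; have xy0 : g' (x - y) = 0 by rewrite linearB xy subrr.
  apply/eqP; rewrite -subr_eq0; apply/eqP.
  apply: inj2; rewrite linear0; apply: cst_eq => n t; rewrite cst_at0.
  apply: (m_inj n (fun t => cst_at (i2 (x - y)) n t)); first exact: sup2.
  by move=> s; rewrite -g'E xy0 linear0 cst_at0.
- move=> z.
  have /choice[x xP] n : exists x : T1 -> V, (forall s, x s != 0 -> U1 s n) /\
       forall t, \sum_s m s t *: x s = cst_at (i0 z) n t.
    by have [|x] := m_surj n (cst_at (i0 z) n); [exact: sup0|exists x].
  have /im1[w wE] : supported U1 (cst_of D x).
    by move=> n t; rewrite cst_ofE; apply: (xP n).1.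
  exists w; apply: inj0; apply: cst_eq => n t; rewrite gE wE.
  by under eq_bigr => s _ do rewrite cst_ofE; apply: (xP n).2.
- move=> x; split=> [gx0|[y <-]].
    have /choice[y yP] n : exists y : T2 -> V, (forall s, y s != 0 -> U2 s n) /\
         forall t, \sum_s m' s t *: y s = cst_at (i1 x) n t.
      have [H _] := m_exact n (cst_at (i1 x) n) (sup1 x n).
      have [|y] := H; last by exists y.
      by move=> t; rewrite -gE gx0 linear0 cst_at0.
    have /im2[w wE] : supported U2 (cst_of D y).
      by move=> n t; rewrite cst_ofE; apply: (yP n).1.
    exists w; apply: inj1; apply: cst_eq => n t; rewrite g'E wE.
    by under eq_bigr => s _ do rewrite cst_ofE; apply: (yP n).2.
  apply: inj0; rewrite linear0; apply: cst_eq => n t; rewrite gE cst_at0.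
  have [_ H] := m_exact n (cst_at (i1 (g' y)) n) (sup1 _ n); apply: H.
  exists (cst_at (i2 y) n); first exact: sup2.
  by move=> s; rewrite g'E.
Qed.

(** The simple functor at [d] is the quotient of the representable functor at [d]
    by its radical, the functor supported strictly above [d]. *)
Lemma simp_pd_le n d :
  (forall (K : lmodType B) (i : {linear K -> constant_module D unit V}),
    is_supp (fun _ j => le d j && (j != d)) i -> pd_le n K) ->
  pd_le n.+1 (simple_module D d V).
Proof.
move=> pdr.
have trans i j l : le i j -> le j l -> le i l.
  move=> ij jl; apply: (ico_le (i0 := D) (b := iE D j l 1 * iE D i j 1)).
  rewrite icoM (bigD1 j) //= big1 ?addr0.
    by rewrite !icoE // !eqxx mulr1 oner_eq0.
  by move=> m mj; rewrite icoE // (negPf mj) andbF mul0r.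
have [|P [i [inj_i iP]]] :=
    @supported_submodule _ _ _ _ D unit V (fun _ => le d).
  by move=> _ l j; apply: trans.
have [|K [j [inj_j jK]]] :=
    @supported_submodule _ _ _ _ D unit V (fun _ j => le d j && (j != d)).
  move=> _ l j /andP[dl ld] lj; rewrite (trans _ _ _ dl lj); apply: contra ld.
  by move=> /eqP jd; apply/eqP/(ile_anti D); rewrite dl -jd lj.
have [|f fE] := linear_factor (i := i) (f := j) inj_i.
  by move=> x; apply/iP => l t /((jK _).2 (ex_intro _ x erefl)) /andP[].
have [|p pE] := @linear_ex B P (simple_module D d V) (fun x => cst_at (i x) d tt).
  move=> b x y; rewrite linearP cst_atD cst_atZ simp_scaleE; congr (_ + _).
  rewrite (bigD1 d) //= big1 ?addr0 // => l ld.
  have [->|/((iP _).2 (ex_intro _ x erefl)) dl] := eqVneq (cst_at (i x) l tt) 0.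
    by rewrite scaler0.
  have [->|/(ico_le (i0 := D)) ld'] := eqVneq (co b l d) 0; first by rewrite scale0r.
  by case/eqP: ld; apply: (ile_anti D); rewrite ld' dl.
exists P, K, f, p; split.
- by apply: (supported_projective inj_i iP) => t; left; exists d.
- by move=> x y /(congr1 i); rewrite !fE; apply: inj_j.
- move=> v.
  have /iP[x xE] : supported (fun _ => le d)
      (cst_of D (fun l (_ : unit) => if l == d then v else 0)).
    move=> l t; rewrite cst_ofE; have [-> _|_] := eqVneq l d; last by rewrite eqxx.
    exact: (ile_refl D).
  by exists x; rewrite pE xE cst_ofE eqxx.
- move=> y; split=> [y0|[x <-]].
    have /jK[x xE] : supported (fun _ j => le d j && (j != d)) (i y).
      move=> l t ly; rewrite ((iP _).2 (ex_intro _ y erefl) _ _ ly) /=.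
      by apply: contra ly => /eqP ->; case: t; rewrite -pE y0.
    by exists x; apply: inj_i; rewrite fE.
  rewrite pE fE; apply/eqP; apply/negP => /negP.
  by move=> /((jK _).2 (ex_intro _ x erefl)); rewrite eqxx andbF.
- exact: (pdr K j).
Qed.

End SupportedResolutions.

(** * Arithmetic of two generators *)

Section TwoGenerators.
Local Open Scope nat_scope.
Variables p q : nat.

Definition two_gen : pred nat :=
  fun s => `[< exists u v, s = u * p + v * q >].

Lemma two_genP s : reflect (exists u v, s = u * p + v * q) (two_gen s).
Proof. exact: asboolP. Qed.

(** Divisibility of monomials in positive degrees; the index 0, which will stand
    for the summand [k[x]], is put below everything. *)
Definition tle : rel nat := fun d n => (d == 0) || (d <= n) && two_gen (n - d).

Lemma tleP d n : 0 < d ->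
  reflect (exists u v, n = d + (u * p + v * q)) (tle d n).
Proof.
move=> d0; rewrite /tle eqn0Ngt d0 /=.
apply: (iffP andP) => [[dn /two_genP[u [v uv]]]|[u [v ->]]].
  by exists u, v; rewrite -uv subnKC.
by split; [exact: leq_addr|apply/two_genP; exists u, v; rewrite addKn].
Qed.

Lemma tle_trans : transitive tle.
Proof.
move=> m d n; have [->//|d0] := posnP d; move=> /(tleP _ d0)[u [v ->]].
have m0 : 0 < d + (u * p + v * q) by rewrite addn_gt0 d0.
move=> /(tleP _ m0)[u' [v' ->]]; apply/tleP => //.
by exists (u + u'), (v + v'); rewrite !mulnDl; lia.
Qed.

Lemma tle_leq d n : tle d n -> d <= n.
Proof. by have [->//|d0] := posnP d; move=> /(tleP _ d0)[u [v ->]]; apply: leq_addr. Qed.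

Lemma tle_split d n : 0 < d -> tle d n -> d != n ->
  tle (d + p) n || tle (d + q) n.
Proof.
move=> d0 /(tleP _ d0)[[|u] [[|v] ->]] dn.
- by case/eqP: dn; rewrite addn0.
- by apply/orP; right; apply/tleP; [lia|exists 0, v; lia].
- by apply/orP; left; apply/tleP; [lia|exists u, 0; lia].
- by apply/orP; left; apply/tleP; [lia|exists u, v.+1; lia].
Qed.

Lemma tle_addp d : 0 < d -> tle d (d + p).
Proof. by move=> d0; apply/tleP => //; exists 1, 0; lia. Qed.

Lemma tle_addq d : 0 < d -> tle d (d + q).
Proof. by move=> d0; apply/tleP => //; exists 0, 1; lia. Qed.

Hypothesis p1 : 1 < p.

(** The residue of [N - w * q] modulo [p]: as [p - 1] is congruent to [-1], the
    truncated subtraction is avoided. *)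
Definition res (N w : nat) : nat := (N + w * (q * p.-1)) %% p.

Lemma res_lt N w : res N w < p.
Proof. by rewrite ltn_mod; lia. Qed.

Lemma resP N w : res N w + w * q = N %[mod p].
Proof.
rewrite /res modnDml -addnA -mulnDr -mulnSr prednK; last by lia.
by rewrite mulnA addnC modnMDl.
Qed.

Lemma res_step N w : (res N w + q * p.-1) %% p = res N w.+1.
Proof. by rewrite /res modnDml mulSn -addnA [X in N + X]addnC. Qed.

Lemma tle_shift r n : r < p ->
  tle ((r + q * p.-1) %% p + 1 + q) n -> tle r.+1 n.
Proof.
move=> rp; set t := _ %% p => T; apply: tle_trans T.
have H : t + q = r %[mod p].
  by rewrite /t modnDml -addnA -mulnSr prednK; [rewrite addnC modnMDl|lia].
have rt : r <= t + q by rewrite -(modn_small rp) -H leq_mod.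
apply/tleP => //; exists ((t + q - r) %/ p), 0.
have /divnK -> : p %| t + q - r by rewrite -eqn_mod_dvd // eq_sym; apply/eqP.
lia.
Qed.

Hypothesis pq : coprime p q.

(** Since [q] is invertible modulo [p], [w |-> res N w] is a bijection of the
    residues: the generators [r < p] may be labelled by [w] when working in a
    fixed degree. *)
Lemma res_inj N w w' : w < p -> w' < p -> res N w = res N w' -> w = w'.
Proof.
move=> wp wp' E.
have : w * q = w' * q %[mod p].
  apply/eqP; rewrite -(eqn_modDl (res N w)) {2}E; apply/eqP.
  by rewrite !resP.
move=> /eqP.
wlog le_ww : w w' wp wp' E / w <= w'.
  by move=> H; case/orP: (leq_total w w') => /H; [|rewrite eq_sym => H' /H' ->]; auto.
rewrite eq_sym eqn_mod_dvd ?leq_mul2r ?le_ww ?orbT // -mulnBl Gauss_dvdl //.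
case: (posnP (w' - w)) => [|w0 /dvdn_leq]; lia.
Qed.

Hypothesis q1 : 1 < q.

Lemma tle_res N w : w < p ->
  tle (res N w).+1 N.+1 = (w * q <= N).
Proof.
move=> wp; apply/(@tleP (res N w).+1 N.+1 isT)/idP => [[u [v E]]|wN].
  have {E}E : N = res N w + (u * p + v * q) by lia.
  have : w * q = v * q %[mod p].
    apply/eqP; rewrite -(eqn_modDl (res N w)); apply/eqP.
    by rewrite resP [in LHS]E addnCA modnMDl.
  move=> H; rewrite E; suff : w <= v by rewrite -(leq_pmul2r (ltnW q1)); lia.
  move/eqP: H; have [//|vw] := leqP w v.
  rewrite eqn_mod_dvd ?leq_mul2r ?(ltnW vw) ?orbT // -mulnBl Gauss_dvdl //.
  by move=> /dvdn_leq; lia.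
have E : res N w = (N - w * q) %% p.
  rewrite -(modn_small (res_lt N w)); apply/eqP.
  by rewrite -(eqn_modDr (w * q)) subnK //; apply/eqP/resP.
exists ((N - w * q) %/ p), w; rewrite addSn; congr _.+1.
by rewrite addnA E [_ %% p + _]addnC -divn_eq subnK.
Qed.

Variable a : nat.
Hypothesis aE : a + p + q = p * q.

(** For [X = t^p] and [Y = t^q], the common multiples of [t^d X] and [t^d Y] which
    are not multiples of [t^d XY] come from the relation [X^q = Y^p], of degree
    [pq], which is out of range. *)
Lemma tle_meet d n : 0 < d -> n <= a -> tle (d + p) n -> tle (d + q) n ->
  tle (d + p + q) n.
Proof.
move=> d0 na /(tleP _ (ltn_addr p d0))[u [v nE]] /(tleP _ (ltn_addr q d0))[u' [v' nE']].
apply/tleP; first by lia.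
case: v nE => [|v] nE; last by exists u, v; rewrite nE mulSn; lia.
case: u' nE' => [|u'] nE'; last by exists u', v'; rewrite nE' mulSn; lia.
have E : u.+1 * p = v'.+1 * q by rewrite !mulSn; lia.
have : q %| u.+1 by rewrite -(@Gauss_dvdl q _ p) 1?coprime_sym // E dvdn_mull.
move=> /dvdn_leq => /(_ isT) qu.
have : q * p <= u.+1 * p by rewrite leq_mul2r qu orbT.
by move: aE; rewrite (mulnC p) mulSn; lia.
Qed.

(** The bound on the degree matters when [w = 0]: a representation would involve
    a positive multiple of [p] copies of [q], in degree at least [pq]. *)
Lemma tle_res_add N w : w < p -> N < a ->
  tle (res N w + 1 + q) N.+1 = (0 < w) && (w * q <= N).
Proof.
move=> wp Na; have d0 : 0 < res N w + 1 + q by lia.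
apply/(tleP _ d0)/andP => [[u [v E]]|[w0 wN]].
  have {E}E : N = res N w + (u * p + v.+1 * q) by rewrite mulSn; lia.
  split.
    rewrite lt0n; apply/eqP => w0; move: E; rewrite w0 => E.
    have H : (u * p + v.+1 * q) = 0 %[mod p].
      apply/eqP; rewrite -(eqn_modDl (res N 0)); apply/eqP.
      by rewrite -E addn0 -[res N 0]addn0 -[in RHS](mul0n q) resP.
    move: H; rewrite modnMDl mod0n => /eqP; rewrite -/(dvdn _ _) Gauss_dvdl //.
    move=> /dvdn_leq => /(_ isT) pv.
    have : p * q <= v.+1 * q by rewrite leq_mul2r pv orbT.
    by move: aE; lia.
  rewrite -tle_res //; apply/tleP => //; exists u, v.+1; lia.
have E : res N w = (N - w * q) %% p.
  rewrite -(modn_small (res_lt N w)); apply/eqP.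
  by rewrite -(eqn_modDr (w * q)) subnK //; apply/eqP/resP.
exists ((N - w * q) %/ p), w.-1.
have := divn_eq (N - w * q) p; rewrite -E.
by case: w w0 wN {wp E d0} => // w _ wN; rewrite mulSn in wN *; lia.
Qed.

End TwoGenerators.

(** * Projective dimension of the simple modules *)

Section Simples.
Variables (p q a : nat).
Hypotheses (p1 : (1 < p)%N) (q1 : (1 < q)%N) (pq : coprime p q).
Hypothesis aE : (a + p + q = p * q)%N.
Definition ole : rel 'I_a.+1 := fun d n => tle p q d n.

Variables (k : fieldType) (B : pzRingType) (D : incidence k ole B).
Variable V : lmodType k.

Lemma tle_supp (T : finType) (d : T -> nat) :
  exists (K : lmodType B) (i : {linear K -> constant_module D T V}),
    is_supp (fun t (n : 'I_a.+1) => tle p q (d t) n) i /\ projective_module K.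
Proof.
have [|K [i [inj_i iP]]] :=
    @supported_submodule _ _ _ _ D T V (fun t (n : 'I_a.+1) => tle p q (d t) n).
  by move=> t i j; apply: tle_trans.
exists K, i; split=> //; apply: (supported_projective inj_i iP) => t.
have [da|ad] := leqP (d t) a.
  by left; exists (Ordinal (da : d t < a.+1)%N).
right=> n /=; apply/negP => /tle_leq; have := ltn_ord n; lia.
Qed.

(** The truncated Koszul complex
    [0 -> P_(d+p+q) -> P_(d+p) + P_(d+q) -> P_d], where [P_d] is the representable
    functor at [d], or 0 when [d] exceeds the range of indices. *)
Lemma simp_pos_pd_le2 (d : 'I_a.+1) : (0 < d)%N -> pd_le 2 (simple_module D d V).
Proof.
move=> d0; apply: simp_pd_le => K i iP.
have [K1 [i1 [s1 pr1]]] := tle_supp (fun b : bool => d + (if b then p else q))%N.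
have [K2 [i2 [s2 pr2]]] := tle_supp (fun _ : unit => d + p + q)%N.
pose m (b : bool) (_ : unit) : k := 1.
pose m' (_ : unit) (b : bool) : k := if b then 1 else -1.
have mE (x : bool -> V) t : \sum_s m s t *: x s = x true + x false.
  by rewrite big_bool !scale1r.
have m'E (y : unit -> V) t : \sum_s m' s t *: y s = if t then y tt else - y tt.
  rewrite (big_pred1 tt) => [|[]//].
  by case: t; rewrite /m' ?scale1r ?scaleN1r.
have lt_d (b : bool) (n : 'I_a.+1) :
    tle p q (d + (if b then p else q))%N n -> ole d n && (n != d).
  move=> dn; apply/andP; split.
    by apply: tle_trans dn; case: b; [apply: tle_addp|apply: tle_addq].
  apply/eqP => nd; move: (tle_leq dn); rewrite nd; case: b {dn}; lia.
apply: (is_supp_pd_le1 (m := m) (m' := m') iP s1 s2 pr1 pr2).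
- move=> n x xU t; rewrite mE => x0.
  have [xt|xt] := eqVneq (x true) 0; last by apply: (lt_d true); apply: (xU true).
  by apply: (lt_d false); apply: (xU false); move: x0; rewrite xt add0r.
- move=> n y yU t; rewrite m'E => yt.
  have /yU : y tt != 0 by move: yt; case: t; rewrite ?oppr_eq0.
  apply: tle_trans; case: t {yt}; first by apply: tle_addq; lia.
  by rewrite addnAC; apply: tle_addp; lia.
- move=> n z zU.
  have [z0|znz] := eqVneq (z tt) 0.
    exists (fun=> 0) => [s|t]; first by rewrite eqxx.
    by rewrite mE addr0; case: t.
  have /andP[dn nd] := zU _ znz.
  have := tle_split d0 dn; rewrite eq_sym => /(_ nd).
  case: (boolP (tle p q (d + p)%N n)) => /= [dpn _|_ dqn].
    exists (fun b : bool => if b then z tt else 0) => [[]|[]] //; rewrite ?eqxx //.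
    by rewrite mE addr0.
  exists (fun b : bool => if b then 0 else z tt) => [[]|[]] //; rewrite ?eqxx //.
  by rewrite mE add0r.
- by move=> n y _ /(_ true); rewrite m'E => y0 [].
- move=> n x xU; split=> [/(_ tt)|[y yU yx] t].
    rewrite mE => /eqP; rewrite addrC addr_eq0 => /eqP x0.
    exists (fun=> x true) => [s xs|t]; last by rewrite m'E; case: t.
    apply: (tle_meet p1 pq q1 aE d0); first by have := ltn_ord n.
      exact: (xU true).
    by apply: (xU false); rewrite x0 oppr_eq0.
  by rewrite mE -!yx !m'E subrr.
Qed.

(** The radical of [P_0] is constant on the positive indices: up to a shift it is
    a truncation of [k[t]], which over [k[X, Y]], with [X = t^p] and [Y = t^q],
    has the generators [t^r] for [r < p] and the relations [Y t^r = X^c t^s] with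
    [r + q = s + c * p]. Below, [tau] sends [s] back to [r]. In a fixed degree
    [n = N + 1] the coordinate [rs N w], with [w * q <= N], stands for the monomial
    with factor [Y^w]; the relations identify consecutive monomials, and exactness
    is a telescoping sum. *)
Lemma simp0_pd_le2 : pd_le 2 (simple_module D ord0 V).
Proof.
apply: simp_pd_le => K i iP.
have [K1 [i1 [s1 pr1]]] := tle_supp (fun r : 'I_p => r.+1).
have [K2 [i2 [s2 pr2]]] := tle_supp (fun r : 'I_p => r + 1 + q)%N.
have p0 : (0 < p)%N by lia.
pose tau (r : 'I_p) : 'I_p := Ordinal (ltn_pmod (r + q * p.-1) p0).
pose rs N w : 'I_p := Ordinal (@res_lt p q p1 N w).
have tau_rs N w : tau (rs N w) = rs N w.+1.
  by apply: val_inj; rewrite /= res_step.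
pose m (r : 'I_p) (_ : unit) : k := 1.
pose m' (r s : 'I_p) : k := (r == s)%:R - (r == tau s)%:R.
have mE (x : 'I_p -> V) t : \sum_s m s t *: x s = \sum_s x s.
  by apply: eq_bigr => s _; rewrite scale1r.
have m'E (y : 'I_p -> V) t : \sum_s m' s t *: y s = y t - y (tau t).
  under eq_bigr => s _ do rewrite scalerBl.
  rewrite sumrB (bigD1 t) //= big1 => [|s st]; last by rewrite (negPf st) scale0r.
  rewrite [X in _ - X](bigD1 (tau t)) //= [X in _ - (_ + X)]big1 => [|s st].
    by rewrite !eqxx !scale1r !addr0.
  by rewrite (negPf st) scale0r.
have rs_inj N : injective (fun w : 'I_p => rs N w).
  move=> w w' /(congr1 val) /= E; apply: val_inj.
  exact: (res_inj p1 pq (ltn_ord w) (ltn_ord w') E).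
have rs_bij N : bijective (fun w : 'I_p => rs N w) by apply: injF_bij.
have sum_rs N (x : 'I_p -> V) : \sum_s x s = \sum_(w : 'I_p) x (rs N w).
  by rewrite (reindex (fun w : 'I_p => rs N w)) //; apply: onW_bij.
have rs_p N : rs N p = rs N 0%N.
  apply: val_inj; rewrite /= /res mul0n addn0.
  by rewrite addnC mulnC modnMDl.
have tau_inj : injective tau.
  move=> r r' /(congr1 val) /= /eqP; rewrite eqn_modDr !modn_small // => /eqP.
  exact: val_inj.
have nS (n : 'I_a.+1) : n != ord0 -> exists N, (n : nat) = N.+1.
  by case: n => -[|N] // Na _; exists N.
have U0 (n : 'I_a.+1) : (n : nat) = 0%N -> forall d, tle p q d.+1 n = false.
  by move=> -> d; apply/negP => /tle_leq.
apply: (is_supp_pd_le1 (m := m) (m' := m') iP s1 s2 pr1 pr2).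
- move=> n x xU t; rewrite mE => x0; apply/andP; split=> //.
  apply: contra x0 => /eqP n0; rewrite big1 // => s _; apply/eqP.
  by apply: contraT => /xU; rewrite U0 // n0.
- move=> n y yU t; rewrite m'E => y0.
  have [yt|/yU] := eqVneq (y t) 0; last first.
    by apply: tle_trans; rewrite -addn1; apply: tle_addq; lia.
  have /yU : y (tau t) != 0 by move: y0; rewrite yt sub0r oppr_eq0.
  exact: tle_shift.
- move=> n z zU; have [z0|znz] := eqVneq (z tt) 0.
    exists (fun=> 0) => [s|[]]; first by rewrite eqxx.
    by rewrite mE big1.
  have /andP[_ n0] := zU _ znz; have [N nN] := nS n n0.
  exists (fun r => if r == rs N 0%N then z tt else 0) => [s|[]].
    have [-> _|_] := eqVneq s (rs N 0%N); last by rewrite eqxx.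
    by rewrite nN (tle_res p1 pq q1).
  by rewrite mE -big_mkcond big_pred1_eq.
- move=> n y yU Dy s.
  have [n0|n0] := eqVneq n ord0.
    by apply/eqP; apply: contraT => /yU; rewrite n0 addn1 addSn U0.
  have [N nN] := nS n n0; have Na : (N < a)%N by rewrite -ltnS -nN.
  have yw w : y (rs N w) = 0.
    elim: w => [|w IH]; last first.
      by have := Dy (rs N w); rewrite m'E IH tau_rs sub0r => /eqP; rewrite oppr_eq0 => /eqP.
    apply/eqP; apply: contraT => /yU; rewrite nN.
    by rewrite (tle_res_add p1 pq q1 aE).
  by have [f _ fK] := rs_bij N; rewrite -(fK s) yw.
- move=> n x xU; split=> [/(_ tt)|[y yU yx] []]; last first.
    rewrite mE; under eq_bigr => s _ do rewrite -yx m'E.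
    have sum_tau : \sum_s y s = \sum_s y (tau s) by rewrite [LHS](reindex_inj tau_inj).
    by rewrite sumrB sum_tau subrr.
  rewrite mE; have [n0 _|n0] := eqVneq n ord0.
    exists (fun=> 0) => [s|t]; first by rewrite eqxx.
    rewrite m'E subrr; apply/esym/eqP; apply: contraT => /xU.
    by rewrite n0 U0.
  have [N nN] := nS n n0; have Na : (N < a)%N by rewrite -ltnS -nN.
  rewrite (sum_rs N) => sx0.
  have [om omK Kom] := rs_bij N.
  (* the partial sums invert y |-> (y_w - y_(w+1)), the total sum being 0 *)
  pose y r := \sum_(w : 'I_p | (om r <= w)%N) x (rs N w).
  exists y => [r yr|r].
    have [w /andP[rw xw]] : exists w : 'I_p, (om r <= w)%N && (x (rs N w) != 0).
      apply/existsP; apply: contraNT yr; rewrite negb_exists => /forallP H.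
      rewrite /y big1 // => w rw; have := H w; rewrite rw /= negbK => /eqP //.
    have := xU _ xw; rewrite nN (tle_res p1 pq q1) // => wN.
    rewrite -(Kom r) (tle_res_add p1 pq q1 aE) //; apply/andP; split.
      rewrite lt0n; apply: contra yr => /eqP r0; rewrite /y r0 -[X in _ == X]sx0.
      by apply/eqP; apply: eq_bigl => w'.
    by apply: leq_trans wN; rewrite leq_mul2r rw orbT.
  rewrite m'E /y (bigD1 (om r)) //=.
  rewrite Kom (eq_bigl (fun w : 'I_p => (om r).+1 <= w)%N) => [|w]; last first.
    by rewrite ltn_neqAle andbC eq_sym.
  have [rp|rp] := ltnP (om r).+1 p.
    have -> : om (tau r) = Ordinal rp.
      by rewrite -{1}(Kom r) tau_rs (omK (Ordinal rp)).
    by rewrite addrK.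
  have rE : (om r).+1 = p by apply/eqP; rewrite eqn_leq rp andbT.
  have -> : om (tau r) = Ordinal p0.
    by rewrite -{1}(Kom r) tau_rs rE rs_p (omK (Ordinal p0)).
  rewrite [X in _ + X - _]big_pred0 => [|w]; last by rewrite rE leqNgt ltn_ord.
  rewrite [X in _ - X](_ : _ = 0) ?subr0 ?addr0 //.
Qed.

End Simples.

Theorem pd_le2 (p q a : nat) (k : fieldType) (B : pzRingType)
    (D : incidence k (@ole p q a) B) :
  (1 < p)%N -> (1 < q)%N -> coprime p q -> (a + p + q = p * q)%N ->
  forall M : lmodType B, pd_le 2 M.
Proof.
move=> p1 q1 pq aE; apply: (pd_le_of_simples (D := D)).
  by move=> i j; apply: tle_leq.
move=> d V; have [d0|d0] := posnP d; last exact: simp_pos_pd_le2.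
by have -> : d = ord0 by [apply: val_inj]; apply: simp0_pd_le2.
Qed.

(** * Homomorphisms of the standard tilting object *)

Section GradedBasics.
Variables (k : fieldType) (S : natSubmonoid).
Local Notation R := (sgalg k S).

Lemma sgalg_ex (P : {poly k}) : (forall l, P`_l != 0 -> smset S l) ->
  exists r : R, sgalg_val r = P.
Proof.
move=> PS; have H : P \in sgalg_pred S by apply/sgalg_predP.
by exists (SgAlg H).
Qed.

Lemma sgalg_supp (r : R) l : (sgalg_val r)`_l != 0 -> smset S l.
Proof. by have /sgalg_predP := valP r; apply. Qed.

Lemma ghomZ (M N : grmod k S) (f : ghom M N) r x : f (r *: x) = r *: f x.
Proof.
have [fl _] := ghom_homdeg f.
have f0 : f 0 = 0 by have := ghomB f 0 0; rewrite !subrr.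
by have := fl r x 0; rewrite f0 !addr0.
Qed.

Lemma ghom0 (M N : grmod k S) (f : ghom M N) : f 0 = 0.
Proof. by have := ghomB f 0 0; rewrite !subrr. Qed.

Lemma ghom_sum (M N : grmod k S) (f : ghom M N) (T : Type) (s : seq T)
    (P : pred T) (F : T -> M) :
  f (\sum_(t <- s | P t) F t) = \sum_(t <- s | P t) f (F t).
Proof. by apply: (big_morph f (ghomD f) (ghom0 f)). Qed.

Lemma ghom_deg (M N : grmod k S) (f : ghom M N) d x :
  grpc d x -> grpc d (f x).
Proof. by have [_ fd] := ghom_homdeg f; move=> /fd; rewrite addr0. Qed.

(** In [R(m)] the degrees are shifted down by [m], so truncation removes the
    monomials of exponent less than [m]. *)
Lemma trunc_shiftP m (r : R) :
  (r : shift (reg k S) m%:Z) \in trunc_pred (M := shift (reg k S) m%:Z) <->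
  forall l, (l < m)%N -> (sgalg_val r)`_l = 0.
Proof.
split=> [/trunc_predP[s [Hs ->]] l lm|r0].
  rewrite (big_morph (fun x : R => (sgalg_val x)`_l) (id1 := 0) (op1 := +%R));
    [|by move=> x y; rewrite coefD|by rewrite coef0].
  rewrite big_seq big1 // => y /Hs[j /= j0 yj]; apply: yj.
  by lia.
apply/trunc_predP.
have mono i : exists x : R, sgalg_val x = (sgalg_val r)`_i *: 'X^i.
  apply: sgalg_ex => l; rewrite coefZ coefXn.
  have [->|] := eqVneq l i; last by rewrite mulr0 eqxx.
  by rewrite mulr1; apply: sgalg_supp.
have [x xE] := choice mono.
have -> : r = \sum_(i < size (sgalg_val r)) (x i : R).
  apply: val_inj; rewrite raddf_sum /= -[LHS]coefK poly_def.
  by apply: eq_bigr => i _; rewrite /= xE.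
apply: homog_sum_big => i; have [im|mi] := ltnP i m.
  suff -> : x i = 0 by apply: homog_sum0.
  by apply: val_inj; rewrite /= xE r0 // scale0r.
apply: (@homog_sum1 _ _ _ (i%:Z - m%:Z)); first by rewrite /= subr_ge0 lez_nat.
move=> l li /=; rewrite xE coefZ coefXn (_ : (l == i) = false) ?mulr0 //.
by apply/eqP => E; move: li; rewrite E; lia.
Qed.

(** These and the following equations hold by computation; they are stated for
    general modules, where checking them is fast. *)
Lemma dsum_atD (I : finType) (M : I -> grmod k S) (x y : dsum M) i :
  (x + y) i = x i + y i.
Proof. by []. Qed.

Lemma dsum_atZ (I : finType) (M : I -> grmod k S) r (x : dsum M) i :
  (r *: x) i = r *: x i.
Proof. by []. Qed.

Lemma trunc_valD (M : grmod k S) (x y : trunc M) :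
  trunc_val (x + y) = trunc_val x + trunc_val y.
Proof. by []. Qed.

Lemma trunc_valZ (M : grmod k S) r (x : trunc M) :
  trunc_val (r *: x) = r *: trunc_val x.
Proof. by []. Qed.

Lemma shift_regD m (x y : shift (reg k S) m) :
  sgalg_val (x + y) = sgalg_val x + sgalg_val y.
Proof. by []. Qed.

Lemma shift_regZ m r (x : shift (reg k S) m) :
  sgalg_val (r *: x) = sgalg_val r * sgalg_val x.
Proof. by []. Qed.

End GradedBasics.

Section StandardTilting.
Variables (k : fieldType) (S : natSubmonoid) (n : nat).
Local Notation R := (sgalg k S).
Local Notation V := (std_tilting k S n%:Z).
Local Notation I := 'I_n.+1.

(** Elements of the tilting object as families of polynomials: the [i]-th one is
    supported on the elements of [S] greater than [i], since summands are counted
    from 0. *)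
Definition pol (x : V) (i : I) : {poly k} := sgalg_val (trunc_val (x i)).

Lemma polD x y i : pol (x + y) i = pol x i + pol y i.
Proof. by rewrite /pol dsum_atD trunc_valD shift_regD. Qed.

Lemma polZ r x i : pol (r *: x) i = sgalg_val r * pol x i.
Proof. by rewrite /pol dsum_atZ trunc_valZ shift_regZ. Qed.

Lemma pol0 i : pol 0 i = 0.
Proof. by apply: (addrI (pol 0 i)); rewrite -polD !addr0. Qed.

Lemma pol_sum (T : Type) (s : seq T) (P : pred T) (F : T -> V) i :
  pol (\sum_(t <- s | P t) F t) i = \sum_(t <- s | P t) pol (F t) i.
Proof.
by apply: (big_morph (fun x => pol x i)) => [x y|]; rewrite ?polD ?pol0.
Qed.

Lemma pol_inj x y : (forall i, pol x i = pol y i) -> x = y.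
Proof.
move=> xy; apply: functional_extensionality_dep => i.
by apply: val_inj; apply: val_inj; apply: xy.
Qed.

Lemma pol_supp x i l : (pol x i)`_l != 0 -> smset S l /\ (i < l)%N.
Proof.
move=> xl; split; first exact: sgalg_supp xl.
rewrite ltnNge; apply: contra xl => li; apply/eqP.
have := valP (x i); move=> /trunc_shiftP; apply.
by rewrite ltnS.
Qed.

Lemma pol_ex (P : I -> {poly k}) :
  (forall i l, (P i)`_l != 0 -> smset S l /\ (i < l)%N) ->
  exists x : V, forall i, pol x i = P i.
Proof.
move=> PS.
have H (i : I) : exists y : trunc (shift (reg k S) i.+1%:Z),
    sgalg_val (trunc_val y) = P i.
  have [r rE] : exists r : R, sgalg_val r = P i.
    by apply: sgalg_ex => l /PS[].
  have rt : (r : shift (reg k S) i.+1%:Z) \in trunc_pred (M := shift (reg k S) i.+1%:Z).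
    apply/trunc_shiftP => l li; rewrite rE; apply/eqP; apply: contraT => /PS[_].
    by rewrite ltnNge -ltnS li.
  by exists (TruncCar rt).
by exists (fun i => sval (cid (H i))) => i; rewrite /pol; case: cid.
Qed.

Lemma pol_deg d x :
  grpc d x <-> forall (i : I) l, l%:Z != i.+1%:Z + d -> (pol x i)`_l = 0.
Proof. by split=> H i; apply: H. Qed.

Hypotheses (nS : ~ smset S n) (gtS : forall s, (n < s)%N -> smset S s).

Lemma tilting_basis : exists b : I -> V, forall i j,
  pol (b i) j = if j == i then 'X^(i.+1 + n) else 0.
Proof.
suff H i : exists x : V, forall j, pol x j = if j == i then 'X^(i.+1 + n) else 0.
  by have [b bE] := choice H; exists b.
apply: pol_ex => j l; have [->|_] := eqVneq j i; last by rewrite coef0 eqxx.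
rewrite coefXn; have [-> _|_] := eqVneq l (i.+1 + n)%N; last by rewrite eqxx.
by split; [apply: gtS|]; lia.
Qed.

(** In degree [n] no gap of [S] is visible in any summand, and these monomials
    form a basis of this degree. *)
Definition bas : I -> V := sval (cid tilting_basis).

Lemma basE i j : pol (bas i) j = if j == i then 'X^(i.+1 + n) else 0.
Proof. exact: (svalP (cid tilting_basis)). Qed.

Lemma bas_deg i : grpc n%:Z (bas i).
Proof.
apply/pol_deg => j l lj; rewrite basE; case: eqP => [ji|_]; last by rewrite coef0.
rewrite coefXn (_ : (l == _) = false) //; apply/eqP => E; move: lj.
by rewrite E ji; lia.
Qed.

(** The matrix of [f] on the part of degree [n], on which it is determined: see
    [ghom_pol]. *)
Definition hom_coef (f : ghom V V) (i j : I) : k := (pol (f (bas i)) j)`_(j.+1 + n).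

Lemma ghom_bas (f : ghom V V) i j : pol (f (bas i)) j = hom_coef f i j *: 'X^(j.+1 + n).
Proof.
apply/polyP => l; rewrite coefZ coefXn.
have [->|lj] := eqVneq l (j.+1 + n)%N; first by rewrite mulr1.
rewrite mulr0; have /pol_deg := ghom_deg f (bas_deg i); apply.
by apply: contra lj => /eqP; lia.
Qed.

Local Notation M := (n.*2.+2 + n)%N.

(** After multiplication by a monomial of large degree, any element is a
    combination of the basis: all exponents involved are past the gaps of [S]. *)
Lemma basis_expansion (x : V) : exists (r : R) (c : I -> R),
  [/\ sgalg_val r = 'X^M, r *: x = \sum_i c i *: bas i &
    forall i, sgalg_val (c i) = 'X^(M - (i.+1 + n)) * pol x i].
Proof.
have [r rE] : exists r : R, sgalg_val r = 'X^M.
  apply: sgalg_ex => l; rewrite coefXn.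
  by have [-> _|] := eqVneq l M; [apply: gtS; lia|rewrite eqxx].
have /choice[c cE] (i : I) : exists c : R,
    sgalg_val c = 'X^(M - (i.+1 + n)) * pol x i.
  apply: sgalg_ex => l; rewrite coefXnM; case: ifP; first by rewrite eqxx.
  by move=> H _; apply: gtS; have := ltn_ord i; lia.
exists r, c; split=> //; apply: pol_inj => i.
rewrite polZ pol_sum (bigD1 i) //= big1 ?addr0 => [|j ji]; last first.
  by rewrite polZ basE eq_sym (negPf ji) mulr0.
rewrite polZ basE eqxx rE cE [RHS]mulrAC -exprD subnK //.
by have := ltn_ord i; lia.
Qed.

(** As the modules are torsion-free of rank one, homomorphisms are matrices of
    scalars, up to the shifts. *)
Lemma ghom_pol (f : ghom V V) x j :
  'X^M * pol (f x) j = \sum_i hom_coef f i j *: ('X^(M + j - i) * pol x i).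
Proof.
have [r [c [rE rx cE]]] := basis_expansion x.
have := congr1 (fun y => pol (f y) j) rx.
rewrite ghomZ ghom_sum polZ rE pol_sum => ->; apply: eq_bigr => i _.
rewrite ghomZ polZ ghom_bas cE -scalerAr mulrAC -exprD.
by congr (_ *: ('X^ _ * _)); have := ltn_ord i; lia.
Qed.

Lemma cf_inj f g : (forall i j, hom_coef f i j = hom_coef g i j) -> f = g.
Proof.
move=> fg; apply: ghom_eq => x; apply: pol_inj => j.
have : 'X^M * pol (f x) j = 'X^M * pol (g x) j.
  by rewrite !ghom_pol; apply: eq_bigr => i _; rewrite fg.
by apply: mulfI; rewrite monic_neq0 ?monicXn.
Qed.

Lemma cfD f g i j : hom_coef (f + g) i j = hom_coef f i j + hom_coef g i j.
Proof. by rewrite /hom_coef -coefD -polD. Qed.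

Lemma cf_id i j : hom_coef (ghom_id V) i j = (i == j)%:R.
Proof.
rewrite /hom_coef /= basE eq_sym; case: eqP => [->|_]; last by rewrite coef0.
by rewrite coefXn eqxx.
Qed.

Lemma cf_comp f g i j : hom_coef (ghom_comp f g) i j = \sum_l hom_coef g i l * hom_coef f l j.
Proof.
have /choice[c cE] (l : I) : exists c : R, sgalg_val c = (hom_coef g i l)%:P.
  apply: sgalg_ex => -[_|s]; first by have [] := smsetP S.
  by rewrite coefC eqxx.
have gE : g (bas i) = \sum_l c l *: bas l.
  apply: pol_inj => m; rewrite ghom_bas pol_sum (bigD1 m) //= big1 ?addr0.
    by rewrite polZ basE eqxx cE mul_polyC.
  by move=> l lm; rewrite polZ basE eq_sym (negPf lm) mulr0.
rewrite [LHS]/hom_coef -[ghom_comp f g (bas i)]/(f (g (bas i))) gE.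
rewrite ghom_sum pol_sum coef_sum; apply: eq_bigr => l _.
by rewrite ghomZ polZ cE coefCM.
Qed.

(** The set of degrees of the [i]-th summand is contained in that of the [j]-th
    one; exactly then is there a nonzero map between them. *)
Definition sle : rel I :=
  fun i j => `[< forall s, smset S s -> (i < s)%N -> smset S (s + j - i)%N >].

Lemma sle_leq i j : sle i j -> (i <= j)%N.
Proof.
move=> /asboolP ij; rewrite leqNgt; apply/negP => ji; apply: nS.
have := ij (n + (i - j))%N; rewrite (_ : n + (i - j) + j - i = n)%N; last by lia.
by apply; [apply: gtS|have := ltn_ord i]; lia.
Qed.

Lemma cf_sle f i j : hom_coef f i j != 0 -> sle i j.
Proof.
move=> fij; apply/asboolP => s Ss si.
(* in the j-th summand, f x is a nonzero multiple of 'X^(s + j - i) *)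
have [x xE] : exists x : V, forall l, pol x l = if l == i then 'X^s else 0.
  apply: pol_ex => l m; have [->|_] := eqVneq l i; last by rewrite coef0 eqxx.
  by rewrite coefXn; have [->|] := eqVneq m s; rewrite ?eqxx.
have := congr1 (fun P : {poly k} => P`_(M + (s + j - i))) (ghom_pol f x j).
rewrite /= coefXnM ltnNge leq_addr /= addKn => E.
apply: (sgalg_supp (r := trunc_val (f x j))); rewrite -/(pol (f x) j) E.
rewrite (bigD1 i) //= big1 ?addr0 => [|l li]; last first.
  by rewrite xE (negPf li) mulr0 scaler0.
have -> : (M + (s + j - i) = M + j - i + s)%N by have := ltn_ord i; lia.
by rewrite xE eqxx -exprD coefZ coefXn eqxx mulr1.
Qed.

Lemma cf_unit i j c : sle i j -> exists f : ghom V V,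
  forall i' j', hom_coef f i' j' = c *+ ((i' == i) && (j' == j)).
Proof.
move=> ij; have le_ij := sle_leq ij.
have /choice[F FE] (x : V) : exists y : V, forall l,
    pol y l = if l == j then c *: ('X^(j - i) * pol x i) else 0.
  apply: pol_ex => l m; have [->|_] := eqVneq l j; last by rewrite coef0 eqxx.
  rewrite coefZ coefXnM; case: ltnP => jm; first by rewrite mulr0 eqxx.
  rewrite mulf_eq0 negb_or => /andP[_ /pol_supp[Sm im]].
  split; last by lia.
  have /asboolP/(_ _ Sm im) := ij.
  by rewrite (_ : m - (j - i) + j - i = m)%N //; lia.
have Fp : homdeg 0 F.
  split=> [r x y|d x xd].
    apply: pol_inj => l; rewrite polD polZ !FE; case: eqP => _; last first.
      by rewrite mulr0 addr0.
    by rewrite polD polZ -scalerAr -scalerDr mulrDr mulrCA.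
  rewrite addr0; apply/pol_deg => l m lm; rewrite FE.
  have [lj|_] := eqVneq l j; last by rewrite coef0.
  rewrite coefZ coefXnM; case: ltnP => jm; first by rewrite mulr0.
  have /pol_deg -> := xd; rewrite ?mulr0 //.
  by apply: contra lm => /eqP; rewrite lj; lia.
exists (GHom (introT (ghom_predP F) Fp)) => i' j'; rewrite /hom_coef /= FE basE.
case: eqP => [->|_]; last by rewrite andbF coef0.
rewrite andbT eq_sym; case: eqP => [->|_]; last by rewrite mulr0 scaler0 coef0.
rewrite -exprD coefZ coefXn (_ : _ == _) ?mulr1 //.
by apply/eqP; lia.
Qed.

End StandardTilting.

(** * Graded free modules *)

Section FreeModules.
Variables (k : fieldType) (S : natSubmonoid).
Local Notation R := (sgalg k S).

Definition free_mod (T : finType) (d : T -> int) : grmod k S :=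
  dsum (fun t => shift (reg k S) (- d t)).

Definition free_gen (T : finType) (d : T -> int) (t : T) : free_mod d :=
  fun u => (u == t)%:R : R.

Lemma free_genE (T : finType) (d : T -> int) (z : free_mod d) :
  z = \sum_t (z t : R) *: free_gen d t.
Proof.
apply: functional_extensionality_dep => u.
rewrite dsum_sumE (bigD1 u) //= big1 ?addr0 => [|t tu].
  rewrite -[RHS]/((z u : R) * (u == u)%:R) eqxx mulr1 //.
by rewrite -[LHS]/((z t : R) * (u == t)%:R) eq_sym (negPf tu) mulr0.
Qed.

Lemma free_gen_deg (T : finType) (d : T -> int) t : grpc (d t) (free_gen d t).
Proof.
move=> u; rewrite /free_gen; have [->|_] := eqVneq u t; last exact: grpc0.
rewrite /= /shift_pc addNr => -[|l] //= _; by rewrite coef1.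
Qed.

Lemma free_mod_CM (T : finType) (d : T -> int) m :
  smset S m.+1 -> CM (free_mod d).
Proof.
move=> Sm; split.
  exists #|T|, (fun l => free_gen d (enum_val l)) => z.
  exists (fun l => (z (enum_val l) : R)).
  by rewrite [LHS]free_genE (reindex (fun l : 'I_#|T| => enum_val l)) //;
    apply: onW_bij; apply: enum_val_bij.
move=> z z0; apply: functional_extensionality_dep => t; apply: val_inj.
have [r rE] : exists r : R, sgalg_val r = 'X^(m.+1).
  apply: sgalg_ex => l; rewrite coefXn.
  by have [->|] := eqVneq l m.+1; rewrite ?eqxx.
have : r *: z = 0 by apply: z0; rewrite /sgalg_max /= rE coefXn.
move=> /(congr1 (fun z : free_mod d => sgalg_val (z t : R))).
rewrite -[LHS]/(sgalg_val r * sgalg_val (z t : R)) rE => /eqP.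
by rewrite mulf_eq0 (negPf (monic_neq0 (monicXn _ _))) => /eqP.
Qed.

(** The homogeneous components of finitely many generators still generate, and
    are the images of the basis of a graded free module. *)
Lemma free_cover (P : grmod k S) : fin_gen P ->
  exists (T : finType) (d : T -> int) (f : ghom (free_mod d) P), Defs.surj f.
Proof.
move=> [m [g gP]].
have /choice[s sP] (t : 'I_m) : exists s : seq P,
    (forall y, y \in s -> exists2 j, setT j & grpc j y) /\ g t = \sum_(y <- s) y.
  exact: grpc_span.
pose T := {t : 'I_m & 'I_(size (s t))}.
pose y (u : T) : P := (s (tag u))`_(tagged u).
have /choice[d dP] (u : T) : exists j, grpc j (y u).
  by have [|j _ yj] := (sP (tag u)).1 (y u); [apply: mem_nth|exists j].
pose f (z : free_mod d) : P := \sum_u (z u : R) *: y u.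
have fp : homdeg 0 f.
  split=> [r x z|j z zj].
    rewrite /f scaler_sumr -big_split; apply: eq_bigr => u _ /=.
    by rewrite scalerA -scalerDl.
  rewrite addr0 /f; elim/big_ind: _ => [|v w vj wj|u _]; first exact: grpc0.
    by rewrite -[w]opprK; apply: grpcB vj _; rewrite -sub0r; apply: grpcB wj; apply: grpc0.
  rewrite -[j](subrK (d u)); apply: grpcZ (dP u) => l lj.
  by apply: (zj u); rewrite addrC.
exists T, d, (GHom (introT (ghom_predP f) fp)) => x; have [c ->] := gP x.
exists (fun u => (c (tag u) : R)); rewrite /= /f.
rewrite (eq_bigr (fun t => \sum_(l < size (s t)) c t *: (s t)`_l)) => [|t _].
  by rewrite sig_big_dep.
by rewrite (sP t).2 (big_nth 0) big_mkord scaler_sumr.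
Qed.

End FreeModules.

(** * The stable endomorphism ring as an incidence ring *)

Section StableEndomorphisms.
Variables (k : fieldType) (S : natSubmonoid) (n : nat).
Local Notation R := (sgalg k S).
Local Notation V := (std_tilting k S n%:Z).
Local Notation I := 'I_n.+1.
Hypotheses (nS : ~ smset S n) (gtS : forall s, (n < s)%N -> smset S s).
Local Notation cf := (hom_coef gtS).

(** A map of the [i]-th summand into [R(-e)] sends the monomial of degree [e + n]
    to degree [n] of [R], which is 0; being torsion-free of rank one, it vanishes.
    A nonzero map from [R(-e)] into the [j]-th summand forces [e >= 0], since this
    summand lives in non-negative degrees, so that this monomial exists. *)
Lemma free_factor_cf (T : finType) (d : T -> int)
    (h : ghom V (free_mod k S d)) (g : ghom (free_mod k S d) V) i j :
  cf (ghom_comp g h) i j = 0.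
Proof.
rewrite /hom_coef -[ghom_comp _ _ _]/(g (h (bas k gtS i))).
rewrite [h _]free_genE ghom_sum pol_sum coef_sum big1 // => t _.
rewrite ghomZ polZ.
have [->|gt0] := eqVneq (pol (g (free_gen k S d t)) j) 0; first by rewrite mulr0 coef0.
suff -> : (h (bas k gtS i) t : R) = 0 by rewrite mul0r coef0.
have [e de] : exists e : nat, d t = e.
  have [l gl] : exists l, (pol (g (free_gen k S d t)) j)`_l != 0.
    by exists (size (pol (g (free_gen k S d t)) j)).-1; rewrite -lead_coefE lead_coef_eq0.
  have [_ jl] := pol_supp gl.
  have /pol_deg/(_ j l) := ghom_deg g (@free_gen_deg k S T d t).
  have [lE _|_ gl0] := eqVneq l%:Z (j.+1%:Z + d t); last by rewrite gl0 ?eqxx in gl.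
  by exists (l - j.+1)%N; lia.
(* h maps the monomial y of degree n + e into degree n of k[S], which is 0 *)
have [y yE] : exists y : V, forall l, pol y l = if l == i then 'X^(i.+1 + (n + e)) else 0.
  apply: pol_ex => l m; have [->|_] := eqVneq l i; last by rewrite coef0 eqxx.
  rewrite coefXn; have [-> _|_] := eqVneq m (i.+1 + (n + e))%N; last by rewrite eqxx.
  by split; [apply: gtS|]; lia.
have yd : grpc (n + e)%:Z y.
  apply/pol_deg => l m lm; rewrite yE; have [li|_] := eqVneq l i; last by rewrite coef0.
  rewrite coefXn (_ : (m == _) = false) //; apply/eqP => E; move: lm.
  by rewrite E li; lia.
have hy0 : (h y t : R) = 0.
  apply: val_inj; apply/polyP => l; rewrite coef0.
  have [->|ln] := eqVneq l n.
    by apply/eqP; apply: contraT => /sgalg_supp /nS.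
  have := ghom_deg h yd t; apply; rewrite de; apply: contra ln => /eqP.
  by lia.
have mono s : (n < s)%N -> exists r : R, sgalg_val r = 'X^s.
  move=> ns; apply: sgalg_ex => l; rewrite coefXn.
  by have [-> _|] := eqVneq l s; [apply: gtS|rewrite eqxx].
have [r rE] := mono (n + n.+1)%N ltac:(lia).
have [r' r'E] := mono (n + e + n.+1)%N ltac:(lia).
have rr : r *: y = r' *: bas k gtS i.
  apply: pol_inj => l; rewrite !polZ yE basE rE r'E; case: (l == i); last by rewrite !mulr0.
  by rewrite -!exprD; congr ('X^ _); lia.
have := congr1 (fun y => h y t : R) rr.
rewrite !ghomZ -[LHS]/(r * (h y t : R)) hy0 mulr0 => /esym/(congr1 (@sgalg_val _ _)).
rewrite -[LHS]/(sgalg_val r' * sgalg_val (h (bas k gtS i) t : R)) r'E => /eqP.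
rewrite mulf_eq0 (negPf (monic_neq0 (monicXn _ _))) => /eqP h0.
exact: val_inj.
Qed.

(** A projective object is a direct summand of a graded free module, which is
    itself maximal Cohen-Macaulay. Hence the stable endomorphism ring is the
    endomorphism ring. *)
Lemma stab_cf (f : ghom V V) i j : f \in stab_pred (M := V) (N := V) -> cf f i j = 0.
Proof.
move=> /stab_predP[P [[[fgP tP] liftP] [g [h ->]]]].
have [T [d [p surj_p]]] := free_cover fgP.
have CMF : CM (free_mod k S d) by apply: (@free_mod_CM _ _ _ _ n); apply: gtS.
have [] := liftP (free_mod k S d) P p id CMF (conj fgP tP) (ghom_homdeg p) surj_p.
  exact: ghom_homdeg (ghom_id P).
move=> s sd sE; pose s' := GHom (introT (ghom_predP s) sd).
have -> : ghom_comp g h = ghom_comp (ghom_comp g p) (ghom_comp s' h).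
  by apply: ghom_eq => x /=; rewrite sE.
exact: free_factor_cf.
Qed.

Definition gcf (b : Gamma k S n%:Z) (i j : I) : k := cf (stab_repr b) i j.

Lemma gcf_pi f i j : gcf (stab_pi f) i j = cf f i j.
Proof.
have : stab_pi (stab_repr (stab_pi f)) = stab_pi f by rewrite stab_reprK.
move=> /stab_pi_eq/(stab_cf i j) H.
by rewrite /gcf -[stab_repr _](subrK f) cfD H add0r.
Qed.

(** Right modules are contravariant, and the largest summand [k[x]], of index [n],
    is the target of maps from all others: reversing the indices puts it at 0. *)
Definition Gamma_le : rel I := fun i j => sle S (rev_ord j) (rev_ord i).

Lemma Gamma_incidence : inhabited (incidence k Gamma_le (Gamma k S n%:Z)^c).
Proof.
have /choice[u uE] (z : I * I * k) : exists f : ghom V V, sle S z.1.1 z.1.2 ->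
    forall i j, cf f i j = z.2 *+ ((i == z.1.1) && (j == z.1.2)).
  have [ij|nij] := boolP (sle S z.1.1 z.1.2); last by exists 0.
  by have [f fE] := cf_unit nS gtS z.2 ij; exists f.
constructor.
refine (@Incidence k I Gamma_le (Gamma k S n%:Z)^c
  (fun b i j => gcf b (rev_ord j) (rev_ord i))
  (fun i j c => stab_pi (u (rev_ord j, rev_ord i, c))) _ _ _ _ _ _ _).
- move=> i j /andP[/(sle_leq nS gtS) ij /(sle_leq nS gtS) ji].
  by apply: rev_ord_inj; apply: val_inj; apply/eqP; rewrite eqn_leq ji ij.
- move=> b b' i j; rewrite -[b]stab_reprK -[b']stab_reprK -stab_piD !gcf_pi.
  exact: cfD.
- move=> b b' i j; rewrite -[b]stab_reprK -[b']stab_reprK.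
  rewrite [LHS](_ : _ = gcf (stab_pi (ghom_comp (stab_repr b') (stab_repr b)))
     (rev_ord j) (rev_ord i)); last first.
    by rewrite -stab_end_mulE.
  rewrite gcf_pi cf_comp (reindex_inj rev_ord_inj); apply: eq_bigr => l _.
  by rewrite !gcf_pi mulrC.
- move=> i j; rewrite [LHS]gcf_pi cf_id (inj_eq rev_ord_inj) eq_sym //.
- by move=> b i j; apply: cf_sle.
- move=> b b' bb'; rewrite -[b]stab_reprK -[b']stab_reprK; congr stab_pi.
  apply: (cf_inj (gtS := gtS)) => i j.
  by have := bb' (rev_ord j) (rev_ord i); rewrite !rev_ordK.
- move=> i j c ij i' j'; rewrite gcf_pi uE //= !(inj_eq rev_ord_inj).
  by rewrite andbC.
Qed.

End StableEndomorphisms.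

(** * Numerical semigroups with two generators *)

Section Numerics.
Local Open Scope nat_scope.
Variables p q : nat.
Hypotheses (p1 : 1 < p) (q1 : 1 < q) (pq : coprime p q).

(** Every integer has the form [u * p + v * q] with [0 <= u < q] and [v] possibly
    negative; it is in the semigroup exactly when [v] is not negative. *)
Lemma two_gen_rep s : exists2 u, u < q &
  (exists v, s = u * p + v * q) \/ (exists w, s + w.+1 * q = u * p).
Proof.
pose x := chinese q p s 0.
have qp : coprime q p by rewrite coprime_sym.
have xs : x = s %[mod q] by apply: chinese_modl.
have /dvdnP[y yE] : p %| x.
  by apply/eqP; rewrite -(mod0n p); apply: chinese_modr.
have q0 : 0 < q by lia.
exists (y %% q); first exact: ltn_pmod.
have E : s = y %% q * p %[mod q] by rewrite modnMml -yE xs.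
have [le_us|lt_su] := leqP (y %% q * p) s.
  left; exists ((s - y %% q * p) %/ q); rewrite divnK ?subnKC //.
  by rewrite -eqn_mod_dvd //; apply/eqP.
right; have dv : q %| y %% q * p - s.
  by rewrite -eqn_mod_dvd ?(ltnW lt_su) // eq_sym; apply/eqP.
have /dvdnP[[|w] wE] := dv; first by lia.
by exists w; rewrite -wE subnKC // ltnW.
Qed.

Variable n : nat.
Hypothesis nE : n + p + q = p * q.

Lemma two_gen_gt s : n < s -> two_gen p q s.
Proof.
move=> ns; have [u uq [[v sE]|[w sE]]] := two_gen_rep s; apply/two_genP.
  by exists u, v.
have : u * p <= q.-1 * p by rewrite leq_mul2r; apply/orP; right; lia.
by move: nE sE; case: (q) q1 => // q' _ /=; rewrite !mulSn mulnS (mulnC p); lia.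
Qed.

Lemma two_gen_n : ~~ two_gen p q n.
Proof.
apply/negP => /two_genP[u [v uv]].
have E : u.+1 * p + v.+1 * q = p * q by rewrite !mulSn; lia.
have qu : q %| u.+1.
  rewrite -(@Gauss_dvdl q _ p) 1?coprime_sym //.
  by rewrite -(dvdn_addl _ (dvdn_mull v.+1 (dvdnn q))) E dvdn_mull.
have qu' : q <= u.+1 by apply: dvdn_leq.
have : q * p <= u.+1 * p by rewrite leq_mul2r qu' orbT.
by move: E; rewrite mulSn (mulnC p) mulSn; lia.
Qed.

Lemma two_gen_sym m : m <= n -> ~~ two_gen p q m -> two_gen p q (n - m).
Proof.
move=> mn nm; have [u uq [[v mE]|[w mE]]] := two_gen_rep m.
  by case/negP: nm; apply/two_genP; exists u, v.
apply/two_genP; exists (q.-1 - u), w.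
have uE : (q.-1 - u) * p + u * p = q.-1 * p by rewrite -mulnDl subnK //; lia.
have qE : q.-1 * p + p = p * q by rewrite -[X in _ + X]mul1n -mulnDl addn1 prednK ?(mulnC p); lia.
by move: mE; rewrite mulSn; lia.
Qed.

End Numerics.

Lemma smallest_submonoid (p q : nat) :
  smallest submonoid [set p; q] = [set s | two_gen p q s].
Proof.
apply/seteqP; split=> s.
  apply; split; last first.
    move=> _ [->|->] /=; apply/two_genP.
      by exists 1%N, 0%N; lia.
    by exists 0%N, 1%N; lia.
  split=> [|i j /two_genP[u [v ->]] /two_genP[u' [v' ->]]]; apply/two_genP.
    by exists 0%N, 0%N.
  by exists (u + u')%N, (v + v')%N; rewrite !mulnDl; lia.
move=> /two_genP[u [v ->]] A [[A0 AD] Apq].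
have AM w x : A x -> A (w * x)%N.
  by move=> Ax; elim: w => // w IH; rewrite mulSn; apply: AD.
by apply: AD; apply: AM; apply: Apq; [left|right].
Qed.

Lemma two_gen_cofinite (p q : nat) :
  finite_set (~` [set s | two_gen p q s]) -> [set s | two_gen p q s] <> setT ->
  [/\ (1 < p)%N, (1 < q)%N & coprime p q].
Proof.
move=> fin proper.
have pq : coprime p q.
  rewrite /coprime; set g := gcdn p q.
  have /finite_seqP[s sE] := fin.
  have dvd_g x : two_gen p q x -> (g %| x)%N.
    move=> /two_genP[u [v ->]].
    by rewrite dvdn_add ?dvdn_mull ?dvdn_gcdl ?dvdn_gcdr.
  pose N := \max_(x <- s) x.
  have big x : (N < x)%N -> two_gen p q x.
    move=> Nx; apply: contrapT => nx.
    have xs : x \in s by have : (~` [set s | two_gen p q s]) x by []; rewrite sE.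
    by move: Nx; rewrite ltnNge => /negP; case; apply: (@leq_bigmax_seq _ s xpredT (fun x : nat => x)). 
  have d1 := dvd_g _ (big N.+1 (ltnSn N)).
  by have := dvd_g _ (big N.+2 (leqnSn N.+1)); rewrite -addn1 dvdn_addr // dvdn1.
have not1 x y : x = 1%N \/ y = 1%N -> (x, y) = (p, q) -> False.
  move=> xy1 [xp yq]; apply: proper; apply/seteqP; split=> // s _ /=.
  by apply/two_genP; case: xy1 => E; [exists s, 0%N|exists 0%N, s]; lia.
have [p0|[pE|p1]] : p = 0%N \/ p = 1%N \/ (1 < p)%N by lia.
- by case: (not1 p q) => //; right; move: pq; rewrite p0 /coprime gcd0n => /eqP.
- by case: (not1 p q) => //; left.
have [q0|[qE|q1]] : q = 0%N \/ q = 1%N \/ (1 < q)%N by lia.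
- by case: (not1 p q) => //; left; move: pq; rewrite q0 /coprime gcdn0 => /eqP.
- by case: (not1 p q) => //; right.
by split.
Qed.

Definition in_smset (S : natSubmonoid) (z : int) : Prop :=
  exists2 s, z = s%:Z & smset S s.

(** As [a] is not in [S], [a + p] can only be a multiple of [q], and [a + q] of
    [p]. Hence [a + p + q] is a multiple [t * p * q], and [t > 1] would place [a]
    beyond the Frobenius number. *)
Lemma pseudo_frobenius (p q : nat) (S : natSubmonoid) (a : int) :
  (1 < p)%N -> (1 < q)%N -> coprime p q ->
  (forall s, smset S s <-> two_gen p q s) ->
  ~ in_smset S a -> (forall s, (0 < s)%N -> smset S s -> in_smset S (a + s%:Z)) ->
  exists2 n : nat, a = n%:Z & (n + p + q = p * q)%N.
Proof.
move=> p1 q1 pq SE aS aD.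
have [x ax /SE/two_genP[u [v xE]]] : in_smset S (a + p%:Z).
  by apply: aD; [lia|apply/SE/two_genP; exists 1%N, 0%N; lia].
have [y ay /SE/two_genP[u' [v' yE]]] : in_smset S (a + q%:Z).
  by apply: aD; [lia|apply/SE/two_genP; exists 0%N, 1%N; lia].
case: u xE => [|u] xE; last first.
  case: aS; exists (u * p + v * q)%N; last by apply/SE/two_genP; exists u, v.
  by move: xE; rewrite mulSn; lia.
case: v' yE => [|v'] yE; last first.
  case: aS; exists (u' * p + v' * q)%N; last by apply/SE/two_genP; exists u', v'.
  by move: yE; rewrite mulSn; lia.
have E : (v.+1 * q = u'.+1 * p)%N by rewrite !mulSn; lia.
have /dvdnP[t tE] : (p %| v.+1)%N.
  by rewrite -(@Gauss_dvdl p _ q) // E dvdn_mull.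
have aE : (a + p%:Z + q%:Z = (t * (p * q))%N%:Z)%R.
  by rewrite mulnA -tE mulSn; lia.
have pq_ge : (p + q <= p * q)%N.
  by case: p p1 {pq SE aD aS ax ay xE yE E tE aE} => [//|[//|p']] _; case: q q1 => [//|[//|q']] _; rewrite !mulSn !mulnS; lia.
case: t tE aE => [|[|t]] tE aE; first by lia.
  by exists (p * q - p - q)%N; lia.
case: aS; exists (t.+2 * (p * q) - p - q)%N; first by rewrite !mulSn in aE *; lia.
apply/SE; apply: (@two_gen_gt p q p1 q1 pq (p * q - p - q)); first by lia.
by rewrite !mulSn; lia.
Qed.

(** For [m] outside of [S], the symmetry [m |-> n - m] of the semigroup makes
    [n - m] an element of [S] whose translate by [m] is the gap [n]. So only the
    translations by elements of [S] preserve the tails of [S], apart from those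
    which move the tail past [n]. *)
Lemma Gamma_leE (p q n : nat) (S : natSubmonoid) :
  (1 < p)%N -> (1 < q)%N -> coprime p q -> (n + p + q = p * q)%N ->
  (forall s, smset S s <-> two_gen p q s) ->
  @Gamma_le S n = @ole p q n.
Proof.
move=> p1 q1 pq nE SE; apply/funext => i; apply/funext => j.
have nS : ~ smset S n by move=> /SE; apply/negP; apply: two_gen_n.
have gtS s : (n < s)%N -> smset S s.
  by move=> ns; apply/SE; apply: two_gen_gt nE _ ns.
have [in_ jn] := (ltn_ord i, ltn_ord j).
apply/idP/idP; rewrite /Gamma_le /ole /tle => ij.
  have := sle_leq nS gtS ij; rewrite /= !subSS => le_ij.
  have [//|i0] := eqVneq (i : nat) 0%N; apply/andP; split; first by lia.
  apply: contraT => /(two_gen_sym p1 q1 pq nE) sym.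
  case: nS; move/asboolP: ij => /(_ (n - (j - i))%N) /= H.
  rewrite !subSS in H.
  rewrite (_ : n = n - (j - i) + (n - i) - (n - j))%N; last by lia.
  by apply: H; [apply/SE/sym|]; lia.
apply/asboolP => s Ss si; rewrite /= !subSS in si *.
case/orP: ij => [/eqP i0|/andP[ij /SE Sij]]; first by apply: gtS; lia.
rewrite (_ : s + (n - i) - (n - j) = s + (j - i))%N; last by lia.
by apply: (smsetP S).2.
Qed.

(** * The a-invariant *)

Section AInvariant.
Variables (k : fieldType) (S : natSubmonoid).
Local Notation R := (sgalg k S).

Lemma grpcD (M : grmod k S) j (x y : M) : grpc j x -> grpc j y -> grpc j (x + y).
Proof.
move=> xj yj; rewrite -[y]opprK; apply: grpcB xj _; rewrite -sub0r.
exact: grpcB (grpc0 _ _) yj.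
Qed.

Lemma grpc_sum (M : grmod k S) j (T : eqType) (s : seq T) (F : T -> M) :
  (forall t, t \in s -> grpc j (F t)) -> grpc j (\sum_(t <- s) F t).
Proof.
move=> Fj; rewrite big_seq; elim/big_ind: _ => [|x y xj yj|t ts].
- exact: grpc0.
- exact: grpcD.
- exact: Fj.
Qed.

Lemma homog_decomposition (M : grmod k S) (x : M) :
  exists (J : seq int) (f : int -> M),
    [/\ uniq J, forall j, grpc j (f j) & x = \sum_(j <- J) f j].
Proof.
have [s [sP ->]] := grpc_span x.
have /choice[d dP] (y : M) : exists j, y \in s -> grpc j y.
  have [ys|ys] := boolP (y \in s); last by exists 0.
  by have [j _ yj] := sP y ys; exists j.
exists (undup (map d s)), (fun j => \sum_(y <- [seq y <- s | d y == j]) y); split.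
- exact: undup_uniq.
- move=> j; apply: grpc_sum => y; rewrite mem_filter => /andP[/eqP <-].
  exact: dP.
- under [RHS]eq_bigr => j _ do rewrite big_filter.
  rewrite (exchange_big_dep xpredT) //=; rewrite big_seq [RHS]big_seq.
  apply: eq_bigr => y ys; rewrite big_mkcond.
  rewrite (bigD1_seq (d y)) ?undup_uniq ?mem_undup ?map_f //= eqxx.
  by rewrite big1 ?addr0 // => j jy; rewrite eq_sym (negPf jy).
Qed.

(** The other components of [x] have zero image because the components of [f x]
    are independent. *)
Lemma homdeg_inj_grpc (M N : grmod k S) (f : M -> N) j x :
  homdeg 0 f -> injective f -> grpc j (f x) -> grpc j x.
Proof.
move=> [fl fd] inj_f fxj; have [F FE] := linear_ex fl.
have [J [g [uJ gP xE]]] := homog_decomposition x.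
have fgP i : grpc i (f (g i)) by rewrite -[X in grpc X _]addr0; apply: fd.
pose h i := f (g i) - (if i == j then f x else 0).
have hP i : grpc i (h i).
  by apply: grpcB => //; have [->|_] := eqVneq i j; [|apply: grpc0].
have fx : f x = \sum_(i <- J) f (g i).
  by rewrite xE -FE linear_sum; apply: eq_bigr => i _; rewrite FE.
have g0 i : i != j -> i \in J -> g i = 0.
  move=> ij iJ; apply: inj_f; rewrite -!FE linear0 FE.
  have [jJ|jJ] := boolP (j \in J).
    have := grpc_indep uJ hP _ iJ; rewrite /h (negPf ij) subr0; apply.
    rewrite sumrB -fx (bigD1_seq j) //= eqxx big1 ?addr0 ?subrr // => l lj.
    by rewrite (negPf lj).
  have uJ' : uniq (j :: J) by rewrite /= jJ.
  pose h' i := if i == j then - f x else f (g i).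
  have h'P l : grpc l (h' l).
    rewrite /h'; have [->|_] := eqVneq l j; last exact: fgP.
    by rewrite -sub0r; apply: grpcB => //; apply: grpc0.
  have := @grpc_indep _ _ N (j :: J) h' uJ' h'P _ i.
  rewrite /h' (negPf ij) inE iJ orbT; apply=> //.
  rewrite big_cons eqxx; apply/eqP; rewrite addrC subr_eq0 fx; apply/eqP.
  apply: eq_big_seq => l lJ; case: eqP => // lj.
  by case/negP: jJ; rewrite -lj.
rewrite xE; apply: grpc_sum => i iJ; have [<-|ij] := eqVneq i j; first exact: gP.
by rewrite g0 //; apply: grpc0.
Qed.

(** A map [f] of degree 0 from the syzygy [Om] of [k] to [R(a)] which represents a
    nonzero class does not extend to [P]. If [u] is a homogeneous generator with
    image 1, then [f (r u) = r c x^a] for all [r] in the maximal ideal and some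
    scalar [c], over the ring of Laurent polynomials. Were [c x^a] in [R], sending
    [u] to it would extend [f]. So [c] is not 0 and [a] is not in [S], while
    [x^s c x^a] is in [R] for every positive [s] in [S]. The auxiliary [t] serves
    to read off [c] inside [R]. *)
Lemma a_invariant_pseudo_frobenius (a : int) (t : nat) :
  is_a_invariant k S a -> smset S t -> (0 < t)%N -> in_smset S (a + t%:Z) ->
  ~ in_smset S a /\ forall s, (0 < s)%N -> smset S s -> in_smset S (a + s%:Z).
Proof.
move=> [P [Om [iota [pr [_ [homi inji] [homp surjp] ex [delta [_ _ _ dsurj dker]]]]]]].
move=> St t0 [m mE Sm].
have [f fh f1] : exists2 f, homdeg 0 f & delta 0 f = (1 : k).
  by apply: dsurj => /eqP.
have fext g : homdeg 0 g -> ~ forall x, g (iota x) = f x.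
  move=> gh gf; have [_ H] := dker 0 f fh.
  have /eqP := H (ex_intro2 _ _ g gh gf); rewrite f1.
  by rewrite oner_eq0.
have [il _] := homi; have [I IE] := linear_ex il.
have [pl pd] := homp; have [Pr PrE] := linear_ex pl.
have [fl fd] := fh; have [F FE] := linear_ex fl.
have prZ r x : pr (r *: x) = (sgalg_val r)`_0 * pr x.
  by rewrite -!PrE linearZ.
have const c : exists r : R, sgalg_val r = c%:P.
  apply: sgalg_ex => l; rewrite coefC; have [-> _|_] := eqVneq l 0%N; last by rewrite eqxx.
  by have [] := smsetP S.
have mono s : smset S s -> exists r : R, sgalg_val r = 'X^s.
  by move=> Ss; apply: sgalg_ex => l; rewrite coefXn; have [->|] := eqVneq l s; rewrite ?eqxx.
have [u ud u1] : exists2 u, grpc 0 u & pr u = 1.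
  have [x x1] := surjp 1; have [s [sP xE]] := grpc_span x.
  have [y ys y0] : exists2 y, y \in s & pr y != 0.
    apply: contrapT => none; have /eqP := x1.
    rewrite -PrE xE linear_sum big_seq big1 ?[0 == 1]eq_sym ?oner_eq0 // => y ys.
    by apply/eqP; rewrite PrE; apply: contraT => y0; case: none; exists y.
  have [j _ yj] := sP y ys.
  have j0 : j = 0.
    apply/eqP; apply: contraT => j0; have := pd _ _ yj; rewrite addr0 => /(_ j0) E.
    by rewrite E eqxx in y0.
  have [r rE] := const (pr y)^-1.
  exists (r *: y); last by rewrite prZ rE coefC mulVf.
  rewrite -[0]addr0 -{2}j0; apply: grpcZ yj => l l0.
  by rewrite rE coefC; have [l0'|//] := eqVneq l 0%N; rewrite l0' in l0.
have [rt rtE] := mono t St.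
have [ot otE] : exists o, iota o = rt *: u.
  by apply/ex; rewrite prZ rtE coefXn; case: (t) t0 => // t' _; rewrite mul0r.
have otd : grpc t%:Z ot.
  apply: (homdeg_inj_grpc homi inji); rewrite otE -[t%:Z]addr0.
  apply: grpcZ ud => l lt; rewrite rtE coefXn (_ : (l == t) = false) //.
  by apply/eqP => lE; rewrite lE eqxx in lt.
pose c := (sgalg_val (f ot : R))`_m.
have fot : sgalg_val (f ot : R) = c *: 'X^m.
  apply/polyP => l; rewrite coefZ coefXn; have [->|lm] := eqVneq l m.
    by rewrite mulr1.
  rewrite mulr0; have := fd _ _ otd; apply; rewrite addr0 mE.
  by apply: contra lm => /eqP[->].
have fr r o : (iota o = r *: u) -> 'X^t * sgalg_val (f o : R) = sgalg_val r * (c *: 'X^m).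
  move=> oE; rewrite -fot -rtE.
  have /(congr1 f) : rt *: o = r *: ot.
    by apply: inji; rewrite -!IE !linearZ /= !IE oE otE !scalerA mulrC.
  by rewrite -!FE !linearZ /= !FE => /(congr1 (@sgalg_val _ _)).
(* w plays the part of c x^a *)
have no_w (w : R) : sgalg_deg a w -> ~ ('X^t * sgalg_val w = c *: 'X^m).
  move=> wd wE; have fw r o : iota o = r *: u -> (f o : R) = r * w.
    move=> /fr; rewrite -wE mulrCA.
    have X0 : 'X^t != 0 :> {poly k} by rewrite monic_neq0 ?monicXn.
    by move=> /(mulfI X0) H; apply: val_inj.
  have /choice[o oE] x : exists y, exists2 e : R, sgalg_val e = (pr x)%:P &
      iota y = x - e *: u.
    have [e eE] := const (pr x).
    have [y yE] : exists y, iota y = x - e *: u.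
      apply/ex; rewrite -PrE linearB /= !PrE prZ u1 eE coefC mulr1; exact: subrr.
    by exists y, e.
  have /choice[e eE] x : exists e : R, sgalg_val e = (pr x)%:P by apply: const.
  have oeE x : iota (o x) = x - e x *: u.
    by have [e' e'E ->] := oE x; congr (_ - _ *: _); apply: val_inj; rewrite /= eE e'E.
  have e0 x : pr x = 0 -> e x = 0.
    by move=> x0; apply: val_inj; rewrite /= eE x0 polyC0.
  apply: (fext (fun x => (f (o x) : R) + e x * w)); last first.
    move=> x; have e0x : e (iota x) = 0 by apply: e0; apply/ex; exists x.
    rewrite e0x mul0r addr0; congr (f _); apply: inji.
    by rewrite oeE e0x scale0r subr0.
  have ee x j : grpc j x -> sgalg_deg j (e x).
    move=> /pd; rewrite addr0 => xj; have [j0|/xj/e0 ->] := eqVneq j 0; last first.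
      by move=> l _; rewrite coef0.
    move=> l lj; rewrite eE coefC; have [l0|//] := eqVneq l 0%N.
    by rewrite l0 j0 in lj.
  split=> [r x y|j x xj].
    pose D := o (r *: x + y) - (r *: o x + o y).
    have /fw : iota D = (r * e x + e y - e (r *: x + y)) *: u.
      rewrite -IE linearB linearD linearZ /= !IE !oeE.
      rewrite scalerBl scalerDl -scalerA scalerBr addrACA -opprD.
      by rewrite opprB [LHS]addrC [LHS]addrA subrK.
    rewrite -FE linearB linearD linearZ /= !FE => /eqP.
    rewrite subr_eq => /eqP ->.
    change ((r * e x + e y - e (r *: x + y)) * w + (r * f (o x) + f (o y)) +
      e (r *: x + y) * w = r * (f (o x) + e x * w) + (f (o y) + e y * w) :> R).
    by ring.
  rewrite addr0; apply: grpcD.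
    rewrite -[j]addr0; apply: fd; apply: (homdeg_inj_grpc homi inji); rewrite oeE.
    apply: grpcB => //; rewrite -[j]addr0; apply: grpcZ ud.
    exact: ee.
  rewrite /= /shift_pc addrC; apply: reg_pcZ => //; exact: ee.
have c0 : c != 0.
  apply/eqP => c0; apply: (no_w 0); first by move=> l _; rewrite coef0.
  by rewrite c0 scale0r mulr0.
split=> [[s aE Ss]|s s0 Ss].
  have [r rE] : exists r : R, sgalg_val r = c *: 'X^s.
    apply: sgalg_ex => l; rewrite coefZ coefXn.
    by have [->|_] := eqVneq l s; rewrite // mulr0 eqxx.
  apply: (no_w r); last first.
    by rewrite rE -scalerAr -exprD; congr (_ *: 'X^ _); lia.
  move=> l la; rewrite rE coefZ coefXn (_ : (l == s) = false) ?mulr0 //.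
  by apply/eqP => ls; rewrite ls aE eqxx in la.
have [rs rsE] := mono s Ss.
have [o oE] : exists o, iota o = rs *: u.
  by apply/ex; rewrite prZ rsE coefXn; case: (s) s0 => // s' _; rewrite mul0r.
have := congr1 (fun Q : {poly k} => Q`_(s + m)) (fr rs o oE).
rewrite /= rsE -scalerAr -exprD coefZ coefXn eqxx mulr1 coefXnM.
case: ltnP => [_ c0'|le_t fo]; first by rewrite -c0' eqxx in c0.
exists (s + m - t)%N; first by lia.
by apply: (sgalg_supp (r := f o : R)); rewrite fo.
Qed.

End AInvariant.

(** * The global dimension *)

Theorem corollaryB (k : fieldType) (S : natSubmonoid)
    (cofiniteS : finite_set (~` smset S))
    (properS : smset S <> setT)
    (two_generatedS : exists m n : nat,
        smset S = smallest submonoid [set m; n])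
    (a : int) (a_invariantS : is_a_invariant k S a) :
  gldim_le (Gamma k S a) 2.
Proof.
have [p [q]] := two_generatedS; rewrite smallest_submonoid => Spq.
have SE s : smset S s <-> two_gen p q s by rewrite Spq.
have [p1 q1 pq] : [/\ (1 < p)%N, (1 < q)%N & coprime p q].
  by apply: two_gen_cofinite; rewrite -Spq.
have FE : (p * q - p - q + p + q = p * q)%N by nia.
have gtF s : (p * q - p - q < s)%N -> smset S s.
  by move=> Fs; apply/SE; apply: two_gen_gt FE _ Fs.
pose t := ((p * q - p - q).+1 + absz a)%N.
have at_S : in_smset S (a + t%:Z).
  by exists (absz (a + t%:Z)); [|apply: gtF]; rewrite /t; lia.
have [aS aD] : ~ in_smset S a /\
    forall s, (0 < s)%N -> smset S s -> in_smset S (a + s%:Z).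
  have St : smset S t by apply: gtF; rewrite /t; lia.
  by apply: (a_invariant_pseudo_frobenius a_invariantS St _ at_S); rewrite /t.
have [n aE nE] := pseudo_frobenius p1 q1 pq SE aS aD.
have nS : ~ smset S n by move=> /SE; apply/negP; apply: two_gen_n.
have gtS s : (n < s)%N -> smset S s.
  by move=> ns; apply/SE; apply: two_gen_gt nE _ ns.
have [D] := Gamma_incidence k nS gtS.
rewrite (Gamma_leE p1 q1 pq nE SE) in D.
by rewrite aE => M; apply: (pd_le2 D).
Qed.
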